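(* Let $m\ge1$, $1\leq p<2$, $0\le\alpha\le1$, $\nu\in\{0,1,2,\dots\}$, and let $\varphi\in C^{\nu,\alpha}(\mathbb T^m)$ be a real function such that $\nabla\varphi(\mathbb T^m)$ has positive Lebesgue measure. Suppose $\nu+\alpha\geq2$ and $\nu+\alpha>m(1/p-1/2)$. Then $$\|e^{i\lambda\varphi}\|_{A_p(\mathbb T^m)}\simeq|\lambda|^{m(1/p-1/2)},\qquad |\lambda|\to\infty,\ \lambda\in\mathbb R.$$ In particular, if $\nu+\alpha\ge2$ and $\nu+\alpha>m/2$, then $\|e^{i\lambda\varphi}\|_{A_1(\mathbb T^m)}\simeq|\lambda|^{m/2}$.
   Context: $\mathbb T^m=\mathbb R^m/2\pi\mathbb Z^m$; functions on $\mathbb T^m$ are identified with $2\pi$-periodic functions on $\mathbb R^m$. $\widehat f(k)=(2\pi)^{-m}\int_{\mathbb T^m}f(t)e^{-i(k,t)}dt$; $A_1(\mathbb T^m)$ is the space of continuous $f$ with $\widehat f\in l^1(\mathbb Z^m)$, for $1<p\le2$ $A_p(\mathbb T^m)$ is the space of integrable $f$ with $\widehat f\in l^p$; $\|f\|_{A_p(\mathbb T^m)}=\|\widehat f\|_{l^p(\mathbb Z^m)}$. For $0<\alpha\le1$, $C^{\nu,\alpha}(\mathbb T^m)$ is the class of $\nu$ times differentiable functions all of whose partial derivatives of order $\nu$ (for $\nu=0$, the function itself) satisfy a Lipschitz condition of order $\alpha$; $C^{\nu,0}=C^\nu$. $a(\lambda)\simeq b(\lambda)$ means $c_1\le a(\lambda)/b(\lambda)\le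 c_2$ for all sufficiently large $|\lambda|$ with constants $c_1,c_2>0$ independent of $\lambda$. *)

(* Defs.v *)
From HB Require Import structures.
From mathcomp Require Import all_boot all_order all_algebra.
From mathcomp Require Import all_classical all_reals all_analysis.
Set Implicit Arguments. Unset Strict Implicit. Unset Printing Implicit Defensive.
Import Order.TTheory GRing.Theory Num.Theory.
Import numFieldNormedType.Exports.
Local Open Scope classical_set_scope.
Local Open Scope ring_scope.

Section Defs.
Variable R : realType.

Definition unitv (m : nat) (i : 'I_m) : 'rV[R]_m := delta_mx 0 i.

Definition partial (m : nat) (i : 'I_m) (f : 'rV[R]_m -> R) : 'rV[R]_m -> R :=
  fun x => 'D_(unitv i) f x.

Definition iter_partial (m : nat) (s : seq 'I_m) (f : 'rV[R]_m -> R) :=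
  foldr (fun i g => partial i g) f s.

Definition gradient (m : nat) (f : 'rV[R]_m -> R) (x : 'rV[R]_m) : 'rV[R]_m :=
  \row_i partial i f x.

Definition torus_periodic (m : nat) (f : 'rV[R]_m -> R) :=
  forall (i : 'I_m) x, f (x + (2 * pi) *: unitv i) = f x.

Definition holder (m : nat) (alpha : R) (g : 'rV[R]_m -> R) :=
  exists C : R, forall x y, `|g x - g y| <= C * (`|x - y| `^ alpha).

Definition C_nu_alpha (m nu : nat) (alpha : R) (f : 'rV[R]_m -> R) :=
  (forall s : seq 'I_m, (size s < nu)%N ->
     forall x, differentiable (iter_partial s f) x) /\
  (forall s : seq 'I_m, size s = nu ->
     if alpha == 0 then continuous (iter_partial s f)
     else holder alpha (iter_partial s f)).

Definition box (m : nat) (a b : 'rV[R]_m) : set 'rV[R]_m :=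
  [set x | forall i, a 0 i <= x 0 i <= b 0 i].
Definition vol (m : nat) (a b : 'rV[R]_m) : R := \prod_(i < m) (b 0 i - a 0 i).
Definition lebesgue_null (m : nat) (A : set 'rV[R]_m) :=
  forall e : R, 0 < e -> exists a b : nat -> 'rV[R]_m,
    (forall n i, a n 0 i <= b n 0 i) /\
    A `<=` \bigcup_n box (a n) (b n) /\
    forall N, \sum_(n < N) vol (a n) (b n) <= e.
Definition positive_measure (m : nat) (A : set 'rV[R]_m) := ~ lebesgue_null A.

Fixpoint iint (n : nat) (G : (nat -> R) -> R) : (nat -> R) -> R :=
  match n with
  | 0 => G
  | n'.+1 => fun x => Rintegral lebesgue_measure `[0, 2 * pi]
       (fun t => iint n' G (fun j => if j == n' then t else x j))
  end.
Definition cube_integral (m : nat) (g : 'rV[R]_m -> R) : R :=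
  iint m (fun x => g (\row_(i < m) x (nat_of_ord i))) (fun _ => 0).

(* Fourier coefficients of e^{i lambda phi}:
   hat(k) = (2pi)^{-m} int e^{i(lambda phi(t) - (k,t))} dt,
   given by its real and imaginary parts. *)
Definition kdot (m : nat) (k : 'rV[int]_m) (t : 'rV[R]_m) : R :=
  \sum_(i < m) (k 0 i)%:~R * t 0 i.
Definition fourier_re (m : nat) (lambda : R) (phi : 'rV[R]_m -> R) k : R :=
  (2 * pi) ^- m * cube_integral (fun t => cos (lambda * phi t - kdot k t)).
Definition fourier_im (m : nat) (lambda : R) (phi : 'rV[R]_m -> R) k : R :=
  (2 * pi) ^- m * cube_integral (fun t => sin (lambda * phi t - kdot k t)).
Definition fourier_abs (m : nat) (lambda : R) (phi : 'rV[R]_m -> R) k : R :=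
  Num.sqrt (fourier_re lambda phi k ^+ 2 + fourier_im lambda phi k ^+ 2).

Definition Ap_norm_exp (m : nat) (p : R) (lambda : R) (phi : 'rV[R]_m -> R)
  : \bar R :=
  match esum [set: 'rV[int]_m]
          (fun k => ((fourier_abs lambda phi k) `^ p)%:E) with
  | r%:E => (r `^ p^-1)%:E
  | _ => +oo%E
  end.

Definition asymp_equiv (a : R -> \bar R) (b : R -> R) :=
  exists c1 c2 L : R, 0 < c1 /\ 0 < c2 /\
    forall lambda, L <= `|lambda| ->
      ((c1 * b lambda)%:E <= a lambda /\ a lambda <= (c2 * b lambda)%:E)%E.

End Defs.

(* Main.v *)
Require Import Defs.
From HB Require Import structures.
From mathcomp Require Import all_boot all_order all_algebra.
From mathcomp Require Import all_classical all_reals all_analysis.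
From mathcomp Require Import zify ring lra.
Import Order.TTheory GRing.Theory Num.Theory.
Import numFieldNormedType.Exports.
Local Open Scope classical_set_scope.
Local Open Scope ring_scope.
Set Implicit Arguments.
Unset Strict Implicit.
Unset Printing Implicit Defensive.

(* Write L = |lambda|, f = e^{i lambda phi}, beta = nu + alpha.

   Upper bound. On the scale 1/L all derivatives of lambda * phi of order 1 to nu, and the
   Hoelder seminorm of the last one, are bounded uniformly in lambda, so the differences of
   order nu + 1 of f with step h are O((L h)^beta).  With Bessel's inequality this gives
   sum |f^(k)|^2 = O((L / 2^j)^(2 beta)) over 2^j <= |k| < 2^(j+1).  Hoelder's inequality on
   the cube |k| <= L and on each larger dyadic block, which contains O(2^(jm)) points, yields
   a geometric series, convergent because beta > m (1/p - 1/2).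

   Lower bound. Let n be about sqrt L.  Since grad phi is Lipschitz, near a point x0 and on the
   scale 1/n the function f is close to a plane wave of frequency lambda * grad phi (x0).
   Testing f against |Q|^2, where Q is a trigonometric polynomial of degree O(n) concentrated
   at x0 on that scale, shows that the sum of |f^(k)| over a cube of side O(n) around that
   frequency is at least 1/2, and so the sum of |f^(k)|^p over it is at least c n^(m (1 - p)).
   As grad phi has an image of positive measure, there are at least c (L / n)^m such cubes on
   the lattice n Z^m, and they overlap boundedly often. *)

(** Choice of n. At distance |v| from x0 the Taylor error of lambda * phi is O(L |v|^2), and
    rounding lambda * grad phi (x0) to the lattice n Z^m costs O(n |v|). Both are under control at
    scale 1/n as soon as n^2 >= L. The total obtained, (L / n)^m n^(m (1 - p)) = L^m n^(- m p),
    decreases in n, so the smallest admissible n is best and gives L^(m (1 - p / 2)), the p-th power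
    of the claimed order. No decay of Q away from x0 is ever estimated. The phase error is bounded
    on the whole torus by 1/8 + C n^2 sum_i (1 - cos (x_i - x0_i)), and |Q|^2 (1 - cos (x_i - x0_i))
    integrates exactly to half the sum of squared differences of the coefficients of Q. A
    tent-shaped coefficient array whose width is a large multiple of n makes this small against the
    mass of Q. All integrands are bounded and Lipschitz, and of the iterated integral only
    linearity, monotonicity and translation invariance in each variable are used, so the order of
    integration is never exchanged. Complex functions are carried as pairs of real ones. *)

(** * One-variable calculus *)

Section OneVariable.
Variable R : realType.
Implicit Types (f df F : R -> R) (M a b h x y : R).

Lemma lipschitz_continuous f M :
  (forall x y, `|f x - f y| <= M * `|x - y|) -> continuous f.
Proof.
have M0 : (forall x y, `|f x - f y| <= M * `|x - y|) -> 0 <= M.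
  by move=> /(_ 1 0); rewrite subr0 normr1 mulr1; exact: le_trans.
move=> fl x; have M1 : 0 < M + 1 by rewrite ltr_wpDl// M0.
apply/cvgrPdist_lt => e e0; near=> t.
rewrite (le_lt_trans (fl _ _))//.
rewrite (@le_lt_trans _ _ ((M + 1) * `|x - t|)) ?ler_wpM2r ?lerDl//.
rewrite -ltr_pdivlMl//.
near: t; apply: cvgr_dist_lt => //.
by apply: mulr_gt0 => //; rewrite invr_gt0.
Unshelve. all: by end_near. Qed.

Lemma continuous_segment_integrable f a b : continuous f ->
  (@lebesgue_measure R).-integrable `[a, b] (EFin \o f).
Proof.
move=> cf; apply: continuous_compact_integrable; first exact: segment_compact.
exact: continuous_subspaceT.
Qed.

Lemma is_derive_continuous f df x : is_derive x 1 f (df x) -> {for x, continuous f}.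
Proof.
by move=> fd; apply: differentiable_continuous; apply/derivable1_diffP; case: fd.
Qed.

Lemma mean_value f df a b : (forall x, is_derive x 1 f (df x)) -> a <= b ->
  exists2 c, a <= c <= b & f b - f a = df c * (b - a).
Proof.
move=> fd ab; have cf : {within `[a, b], continuous f}.
  by apply: continuous_subspaceT => x; apply: is_derive_continuous.
have [c] := MVT_segment ab (fun x _ => fd x) cf.
by rewrite in_itv /=; exists c.
Qed.

Lemma derive_bounded_lipschitz f df M : (forall x, is_derive x 1 f (df x)) ->
  (forall x, `|df x| <= M) -> forall x y, `|f x - f y| <= M * `|x - y|.
Proof.
move=> fd dM x y; wlog xy : x y / y <= x.
  by move=> H; case/orP: (le_total y x) => /H //; rewrite distrC [`|y - x|]distrC.
have [c _ ->] := mean_value fd xy.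
by rewrite normrM ler_wpM2r.
Qed.

(** Only points to the right of the base point [A] are covered. Users choose [A] below every point
    they need, which avoids integrals with reversed bounds. *)
Lemma continuous_primitive f A : continuous f ->
  exists F, forall x, A < x -> is_derive x 1 F (f x).
Proof.
move=> cf; exists (fun x => \int[lebesgue_measure]_(t in `[A, x]) f t) => x Ax.
have x1 : x < x + 1 by rewrite ltrDl.
have fi := @continuous_segment_integrable f A (x + 1) cf.
have [d1 d2] := continuous_FTC1_closed x1 fi Ax (cf x).
by split=> //; rewrite -d2 derive1E.
Qed.

Lemma Rintegral_primitive f F A a b : continuous f ->
  (forall x, A < x -> is_derive x 1 F (f x)) -> A < a -> a < b ->
  Rintegral lebesgue_measure `[a, b] f = F b - F a.
Proof.
move=> cf Fd Aa ab.
have cF x : A < x -> {for x, continuous F}.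
  by move=> /Fd; exact: is_derive_continuous.
rewrite /Rintegral (@continuous_FTC2 R f F)//.
- exact: continuous_subspaceT.
- split.
  + move=> x; rewrite in_itv /= => /andP[ax _].
    by have /Fd [] : A < x by exact: lt_trans ax.
  + by apply: cvg_at_right_filter; exact: cF.
  + by apply: cvg_at_left_filter; apply: cF; exact: lt_trans ab.
- move=> x; rewrite in_itv /= => /andP[ax _].
  have /Fd [_ <-] : A < x by exact: lt_trans ax.
  by rewrite derive1E.
Qed.

Lemma is_derive_affine f (d c h x : R) :
  is_derive (x * c + h) 1 f d -> is_derive x 1 (fun t => f (t * c + h)) (d * c).
Proof.
move=> fd; have gd : is_derive x 1 (fun t : R => t * c + h) c.
  have := @is_deriveD R R R (fun t => t * c) (cst h) x 1 c 0.
  rewrite addr0; apply.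
  have -> : (fun t => t * c) = c *: id by apply/funext => t /=; rewrite mulrC.
  by rewrite -[X in is_derive _ _ _ X]mulr1; exact: is_deriveZ.
exact: (@is_derive1_comp R f (fun t => t * c + h)).
Qed.

Lemma is_derive_shift f (d h x : R) :
  is_derive (x + h) 1 f d -> is_derive x 1 (fun t => f (t + h)) d.
Proof.
rewrite -{1}[x]mulr1 => /is_derive_affine; rewrite mulr1.
by under [X in is_derive _ _ X _ -> _]eq_fun do rewrite mulr1.
Qed.

(** For a primitive F, periodicity makes the derivative of F (t + a) - F t vanish, so this increment
    is the same at t = 0 and at t = h. The base point [A] lies below both, since [h] may be
    negative. *)
Lemma Rintegral_periodic_shift f a h : continuous f -> 0 < a ->
  (forall t, f (t + a) = f t) ->
  Rintegral lebesgue_measure `[0, a] (fun t => f (t + h)) =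
  Rintegral lebesgue_measure `[0, a] f.
Proof.
move=> cf a0 per; have [A [A0 Ah]] : exists A, A < 0 /\ A < h.
  exists (- (`|h| + 1)); have := ler_norm (- h); have := normr_ge0 h; rewrite normrN; lra.
have [F Fd] := continuous_primitive A cf.
rewrite (Rintegral_primitive cf Fd A0 a0).
have -> : Rintegral lebesgue_measure `[0, a] (fun t => f (t + h)) = F (a + h) - F (0 + h).
  apply: (@Rintegral_primitive (fun t => f (t + h)) (fun t => F (t + h)) (A - h)) => //; last first.
  - lra.
  - by move=> x Axh; apply: is_derive_shift; apply: Fd; lra.
  move=> x; apply: (@continuous_comp _ _ _ (fun t => t + h) f); last exact: cf.
  by apply: (@cvgD _ R); [exact: cvg_id|exact: cvg_cst].
have D x : A < x -> is_derive x 1 (fun t => F (t + a) - F t) 0.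
  move=> Ax; rewrite -(subrr (f x)) -{1}per.
  by apply: is_deriveB; [apply: is_derive_shift; apply: Fd; lra|exact: Fd].
have cst u v : A < u -> u <= v -> F (u + a) - F u = F (v + a) - F v.
  move=> Au uv.
  have cuv : {within `[u, v], continuous (fun t => F (t + a) - F t)}.
    apply: continuous_in_subspaceT => y; rewrite inE /= in_itv /= => /andP[uy _].
    have Ay : A < y by exact: lt_le_trans uy.
    exact: (@is_derive_continuous (fun t => F (t + a) - F t) (fun=> 0) y (D y Ay)).
  have Duv y : y \in `]u, v[%R -> is_derive y 1 (fun t => F (t + a) - F t) 0.
    by rewrite in_itv /= => /andP[uy _]; apply: D; exact: lt_trans uy.
  have [c _] := @MVT_segment R _ (fun=> 0) u v uv Duv cuv.
  by rewrite mul0r => /eqP; rewrite subr_eq0 => /eqP.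
rewrite add0r [a + h]addrC.
case/orP: (le_total h 0) => h0.
  by rewrite (cst _ _ Ah h0) add0r.
by rewrite -(cst _ _ A0 h0) add0r.
Qed.

Lemma cos_lipschitz x y : `|cos x - cos y| <= `|x - y| :> R.
Proof.
rewrite -[leRHS]mul1r; apply: (@derive_bounded_lipschitz cos (fun x => - sin x)) => t.
by rewrite normrN sin_max.
Qed.

Lemma sin_lipschitz x y : `|sin x - sin y| <= `|x - y| :> R.
Proof.
rewrite -[leRHS]mul1r; apply: (@derive_bounded_lipschitz sin cos) => t.
by rewrite cos_max.
Qed.

Lemma cosD2pi_int x (n : int) : cos (x + n%:~R * (2 * pi)) = cos x :> R.
Proof.
have e : 2 * pi = pi *+ 2 :> R by rewrite mulr_natl.
have pos k y : cos (y + k%:R * (2 * pi)) = cos y :> R.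
  elim: k => [|k IH]; first by rewrite mul0r addr0.
  by rewrite -[in LHS]natr1 mulrDl mul1r addrA {2}e cosD2pi IH.
case: n => k; first by rewrite -pmulrn pos.
rewrite NegzE mulrNz -pmulrn -[LHS](pos k.+1); congr cos; ring.
Qed.

(** It suffices that sin (x/2) >= x/4 for x >= 0, because 1 - cos x = 2 sin^2 (x/2). The mean value
    theorem gives sin (x/4) >= (x/4) cos (x/4); doubling the angle leaves the factor 2 cos^2 (x/4) =
    1 + cos (x/2) >= 1. *)
Lemma sqr_le_1Bcos x : - pi <= x <= pi -> x ^+ 2 <= 8 * (1 - cos x) :> R.
Proof.
wlog x0 : x / 0 <= x => [H|].
  case/orP: (le_total 0 x) => x0; first exact: H.
  move=> xp; rewrite -cosN -sqrrN; apply: H; lra.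
move=> /andP[_ xpi].
have [c /andP[c0 cx]] := @mean_value sin cos 0 (x / 4) (fun=> _) ltac:(lra).
rewrite sin0 !subr0 => sE.
have pi0 := pi_gt0 R.
have cc : cos (x / 4) <= cos c.
  have := @ltr_cos R c (x / 4); rewrite !in_itv /= => lc.
  by case: (ltrP c (x / 4)) => cx4; [apply/ltW; rewrite lc; lra|have -> : c = x / 4 by lra].
have cg : 0 <= cos (x / 4) by apply: cos_ge0_pihalf; lra.
have cg2 : 0 <= cos (x / 2) by apply: cos_ge0_pihalf; lra.
have x2 : x / 2 = x / 4 *+ 2 by rewrite mulr2n; field.
have x1 : x = x / 2 *+ 2 by rewrite mulr2n; field.
have e1 : cos (x / 2) = 2 * cos (x / 4) ^+ 2 - 1.
  by rewrite {1}x2 cos_mulr2n -(mulr_natl _ 2).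
have e2 : cos x = 2 * cos (x / 2) ^+ 2 - 1.
  by rewrite {1}x1 cos_mulr2n -(mulr_natl _ 2).
have e3 := cos2Dsin2 (x / 2).
have e4 : sin (x / 2) = 2 * (cos (x / 4) * sin (x / 4)).
  by rewrite {1}x2 sin_mulr2n -(mulr_natl _ 2).
have s4 : x / 4 * cos (x / 4) <= sin (x / 4) by rewrite sE mulrC; apply: ler_wpM2r; lra.
have s2 : x / 4 <= sin (x / 2).
  rewrite e4.
  have : cos (x / 4) * (x / 4 * cos (x / 4)) <= cos (x / 4) * sin (x / 4).
    by rewrite ler_wpM2l.
  have : 2^-1 <= cos (x / 4) ^+ 2 by lra.
  move: (cos _) (sin _) => C S; nra.
have : (x / 4) ^+ 2 <= sin (x / 2) ^+ 2 by rewrite ler_pXn2r// ?nnegrE; lra.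
have -> : (x / 4) ^+ 2 = x ^+ 2 / 16 by field.
lra.
Qed.

End OneVariable.

(** * Iterated integrals *)

Section IteratedIntegral.
Variable R : realType.
Implicit Types (G H : (nat -> R) -> R) (x y : nat -> R) (M c : R) (m n : nat).

(** Convertible to the assignment that [iint] builds inline. *)
Definition update x n (t : R) : nat -> R := fun j => if j == n then t else x j.

Definition dist1 m x y : R := \sum_(j < m) `|x j - y j|.

(* Boundedness and Lipschitz continuity are inherited by partial integrals, so that every inner
   integrand of iint is continuous. *)
Definition lipn m M G := (forall x, `|G x| <= M) /\
  (forall x y, `|G x - G y| <= M * dist1 m x y).

Lemma dist1_update m x y n (t : R) : dist1 m (update x n t) (update y n t) <= dist1 m x y.
Proof.
apply: ler_sum => j _; rewrite /update; case: ifP => // _.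
by rewrite subrr normr0.
Qed.

Lemma dist1_update2 m x n (s t : R) : dist1 m (update x n s) (update x n t) <= `|s - t|.
Proof.
rewrite /dist1; case: (ltnP n m) => nm.
  rewrite (bigD1 (Ordinal nm)) //= /update eqxx big1 ?addr0// => j /eqP jn.
  case: eqP => [e|_]; last by rewrite subrr normr0.
  by exfalso; apply: jn; apply: val_inj.
rewrite big1 // => j _; rewrite /update; case: eqP => [e|_]; last by rewrite subrr normr0.
by move: (ltn_ord j); rewrite e ltnNge nm.
Qed.

Lemma lipn_ge0 m M G : lipn m M G -> 0 <= M.
Proof. by move=> [/(_ (fun=> 0))/(le_trans _)] b _; apply: b. Qed.

Lemma lipn_update_continuous m M G x n : lipn m M G -> continuous (fun t => G (update x n t)).
Proof.
move=> lG; apply: (@lipschitz_continuous _ _ M) => s t.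
apply: (le_trans (lG.2 _ _)); rewrite ler_wpM2l ?(lipn_ge0 lG)//.
exact: dist1_update2.
Qed.

Lemma lipn_update_integrable m M G x n (a : R) : lipn m M G ->
  (@lebesgue_measure R).-integrable `[0, a] (EFin \o (fun t => G (update x n t))).
Proof.
by move=> lG; apply: continuous_segment_integrable; apply: lipn_update_continuous lG.
Qed.

Lemma Rintegral_segment_bound (f : R -> R) (a M : R) : 0 <= a -> continuous f ->
  (forall t, `|f t| <= M) -> `|Rintegral lebesgue_measure `[0, a] f| <= a * M.
Proof.
move=> a0 cf fM; have fi := @continuous_segment_integrable R f 0 a cf.
apply: (le_trans (le_normr_Rintegral _ fi)) => //.
have <- : Rintegral lebesgue_measure `[0, a] (cst M) = a * M.
  rewrite Rintegral_cst//= lebesgue_measure_itv/= lte_fin.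
  by case: ltP => /= a0'; [rewrite oppr0 addr0 mulrC|have -> : a = 0 by lra]; rewrite ?mulr0 ?mul0r.
apply: le_Rintegral => //.
- apply: continuous_segment_integrable => x; apply: continuous_comp; first exact: cf.
  exact: norm_continuous.
- apply: continuous_segment_integrable => x; exact: cvg_cst.
Qed.

Lemma pi2_gt0 : 0 < 2 * pi :> R.
Proof. by rewrite mulr_gt0// pi_gt0. Qed.

Lemma pi2_ge0 : 0 <= 2 * pi :> R.
Proof. exact/ltW/pi2_gt0. Qed.

Lemma iint_lipn m n M G : lipn m M G -> lipn m ((2 * pi) ^+ n * M) (iint n G).
Proof.
move=> lG; elim: n => [|n IH]; first by rewrite expr0 mul1r.
have cI x : continuous (fun t => iint n G (update x n t)).
  exact: lipn_update_continuous IH.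
split=> [x|x y] /=.
  rewrite exprS -mulrA; apply: Rintegral_segment_bound; [exact: pi2_ge0|exact: cI|].
  by move=> t; apply: IH.1.
rewrite -RintegralB//; try exact: (lipn_update_integrable _ _ _ IH).
rewrite exprS; rewrite [leRHS](_ : _ = (2 * pi) * ((2 * pi) ^+ n * M * dist1 m x y)); last by ring.
apply: Rintegral_segment_bound; first exact: pi2_ge0.
  by move=> t; apply: continuousB; exact: cI.
move=> t; apply: le_trans (IH.2 _ _) _; apply: ler_wpM2l; first exact: lipn_ge0 IH.
exact: dist1_update.
Qed.

Lemma lipn_iint_integrable m n M G x : lipn m M G ->
  (@lebesgue_measure R).-integrable `[0, 2 * pi] (EFin \o (fun t => iint n G (update x n t))).
Proof. by move=> lG; apply: lipn_update_integrable (iint_lipn n lG). Qed.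

Lemma eq_iint n G H : G =1 H -> iint n G =1 iint n H.
Proof. by move=> /funext ->. Qed.

Lemma iintD m n M M' G H x : lipn m M G -> lipn m M' H ->
  iint n (fun x => G x + H x) x = iint n G x + iint n H x.
Proof.
move=> lG lH; elim: n x => //= n IH x.
rewrite -RintegralD//; [by apply: eq_Rintegral => t _; rewrite IH| |].
- exact: (lipn_iint_integrable n x lG).
- exact: (lipn_iint_integrable n x lH).
Qed.

Lemma iintZ m n M G c x : lipn m M G ->
  iint n (fun x => c * G x) x = c * iint n G x.
Proof.
move=> lG; elim: n x => //= n IH x.
rewrite -RintegralZl//; [by apply: eq_Rintegral => t _; rewrite IH|].
exact: (lipn_iint_integrable n x lG).
Qed.

Lemma le_iint m n M M' G H x : lipn m M G -> lipn m M' H -> (forall x, G x <= H x) ->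
  iint n G x <= iint n H x.
Proof.
move=> lG lH GH; elim: n x => //= n IH x.
apply: le_Rintegral => //; try by move=> t _; exact: IH.
- exact: (lipn_iint_integrable n x lG).
- exact: (lipn_iint_integrable n x lH).
Qed.

Lemma iint_cst n c x : iint n (fun=> c) x = (2 * pi) ^+ n * c.
Proof.
elim: n x => [|n IH] x /=; first by rewrite mul1r.
under eq_Rintegral do rewrite IH.
rewrite Rintegral_cst//= lebesgue_measure_itv/= lte_fin pi2_gt0 /= oppr0 addr0 exprS.
by ring.
Qed.

Lemma update_comm x i n (s t : R) : i != n ->
  update (update x n t) i s = update (update x i s) n t.
Proof.
move=> ni; apply/funext => j; rewrite /update.
by case: (eqVneq j i) => [->|//]; rewrite (negbTE ni).
Qed.

(** [iint n] integrates the variables below [n] only, so a substitution in variable [i] passes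
    through it. *)
Lemma iint_shift_outer n G (i : nat) h x : (n <= i)%N ->
  iint n (fun x => G (update x i (x i + h))) x = iint n G (update x i (x i + h)).
Proof.
elim: n x => //= n IH x ni.
apply: eq_Rintegral => t _; rewrite IH ?(ltnW ni)//.
congr (iint n G _); rewrite -/(update _ _ _) -/(update _ _ _) /= -update_comm; last by lia.
by congr update; rewrite /update; case: eqP => // e; lia.
Qed.

(** Induction on [n]. If [i] is the outermost variable, the shift is moved outside the inner
    integrals and the one-variable result applies; otherwise it stays under the outer integral. *)
Lemma iint_shift m n M G (i : nat) h x : lipn m M G -> (i < n)%N ->
  (forall x, G (update x i (x i + 2 * pi)) = G x) ->
  iint n (fun x => G (update x i (x i + h))) x = iint n G x.
Proof.
move=> lG + per; elim: n x => //= n IH x; rewrite ltnS leq_eqVlt => /predU1P[e|ni].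
  rewrite e in per *; have cf : continuous (fun t => iint n G (update x n t)).
    exact: lipn_update_continuous (iint_lipn n lG).
  rewrite -[RHS](Rintegral_periodic_shift h cf pi2_gt0).
    apply: eq_Rintegral => t _; rewrite iint_shift_outer//; congr iint.
    by apply/funext => j; rewrite /update eqxx; case: eqP.
  move=> t; transitivity (iint n (fun x => G (update x n (x n + 2 * pi))) (update x n t)).
    rewrite iint_shift_outer//; congr (iint n G _).
    by apply/funext => j; rewrite /update eqxx; case: eqP.
  exact: eq_iint.
by apply: eq_Rintegral => t _; exact: IH.
Qed.

End IteratedIntegral.

(** * Integration over the torus *)

Section CubeIntegral.
Variables (R : realType) (m : nat).
Implicit Types (g h u v : 'rV[R]_m -> R) (x y : 'rV[R]_m) (c w : R) (k : 'rV[int]_m).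

Definition norm1 x : R := \sum_i `|x 0 i|.

Definition lipschitz1 M g := forall x y, `|g x - g y| <= M * norm1 (x - y).

(** The class of integrands used throughout: closed under sums, products and translations, and
    mapped into [lipn], where every partial integral is again continuous. The l^1 norm matches
    [dist1]. *)
Definition blip g := exists M, (forall x, `|g x| <= M) /\ lipschitz1 M g.

Local Notation V := ((2 * pi) ^+ m : R).

Lemma norm1_ge0 x : 0 <= norm1 x.
Proof. exact: sumr_ge0. Qed.

Lemma norm1_unitv c i : norm1 (c *: unitv R i) = `|c|.
Proof.
rewrite /norm1 (bigD1 i) //= big1 => [|j ji].
  by rewrite !mxE !eqxx mulr1 addr0.
by rewrite !mxE (negbTE ji) andbF mulr0 normr0.
Qed.

Lemma blip_ge0 M g : (forall x, `|g x| <= M) -> 0 <= M.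
Proof. by move=> /(_ 0); exact: le_trans. Qed.

Lemma blip_lipn g : blip g -> exists M, lipn m M (fun x : nat ->
  R => g (\row_(i < m) x (nat_of_ord i))).
Proof.
move=> [M [b l]]; exists M; split=> [x|x y]; first exact: b.
apply: le_trans (l _ _) _; apply: ler_wpM2l; first exact: blip_ge0 b.
by apply: ler_sum => j _; rewrite !mxE.
Qed.

Lemma cube_integral_ext g h : g =1 h -> cube_integral g = cube_integral h.
Proof. by move=> /funext ->. Qed.

Lemma cube_integralD g h : blip g -> blip h ->
  cube_integral (fun x => g x + h x) = cube_integral g + cube_integral h.
Proof. by move=> /blip_lipn[M lg] /blip_lipn[M' lh]; exact: iintD lg lh. Qed.

Lemma cube_integralZ c g : blip g -> cube_integral (fun x => c * g x) = c * cube_integral g.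
Proof. by move=> /blip_lipn[M lg]; exact: iintZ lg. Qed.

Lemma le_cube_integral g h : blip g -> blip h -> (forall x, g x <= h x) ->
  cube_integral g <= cube_integral h.
Proof. by move=> /blip_lipn[M lg] /blip_lipn[M' lh] gh; exact: le_iint lg lh _. Qed.

Lemma cube_integral_cst c : cube_integral (fun _ : 'rV[R]_m => c) = V * c.
Proof. exact: iint_cst. Qed.

Lemma cube_integral_shift g i c : blip g -> torus_periodic g ->
  cube_integral (fun x => g (x + c *: unitv R i)) = cube_integral g.
Proof.
move=> /blip_lipn[M lg] per.
have E (x : nat -> R) (d : R) : \row_(j < m) update x i (x i + d) j = (\row_(j < m) x j) + d *:
    unitv R i.
  apply/rowP => j; rewrite !mxE /update eqxx /=.
  by case: eqP => [/val_inj ->|ji]; rewrite ?eqxx ?mulr1//; case: eqP => [/(congr1 val)//|];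
      rewrite mulr0 addr0.
rewrite /cube_integral -[RHS](iint_shift c _ lg (ltn_ord i)).
  by apply: eq_iint => x; rewrite E.
by move=> x; rewrite E per.
Qed.

Lemma blip_cst c : blip (fun _ => c).
Proof.
exists `|c|; split=> // x y; rewrite subrr normr0 mulr_ge0 ?norm1_ge0//.
Qed.

Lemma blipD g h : blip g -> blip h -> blip (fun x => g x + h x).
Proof.
move=> [M [b l]] [M' [b' l']]; exists (M + M'); split=> [x|x y].
  by apply: le_trans (ler_normD _ _) _; apply: lerD.
rewrite opprD addrACA mulrDl; apply: le_trans (ler_normD _ _) _; apply: lerD; [exact: l|exact: l'].
Qed.

Lemma blipM g h : blip g -> blip h -> blip (fun x => g x * h x).
Proof.
move=> [M [b l]] [M' [b' l']].
have M0 := blip_ge0 b; have M'0 := blip_ge0 b'.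
exists (M * M' + M * M'); split=> [x|x y].
  rewrite normrM; apply: (@le_trans _ _ (M * M')); first exact: ler_pM.
  by rewrite lerDl mulr_ge0.
have -> : g x * h x - g y * h y = g x * (h x - h y) + h y * (g x - g y) by ring.
apply: le_trans (ler_normD _ _) _; rewrite !normrM mulrDl; apply: lerD.
  by rewrite -mulrA; apply: ler_pM => //; exact: l'.
by rewrite [M * M']mulrC -mulrA; apply: ler_pM => //; exact: l.
Qed.

Lemma blipZ c g : blip g -> blip (fun x => c * g x).
Proof. by move=> bg; apply: blipM => //; exact: blip_cst. Qed.

Lemma blipN g : blip g -> blip (fun x => - g x).
Proof.
by move=> /(blipZ (-1)); under [X in blip X -> _]eq_fun do rewrite mulN1r.
Qed.

Lemma blipB g h : blip g -> blip h -> blip (fun x => g x - h x).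
Proof. by move=> bg bh; apply: blipD => //; exact: blipN. Qed.

Lemma blip_sqr g : blip g -> blip (fun x => g x ^+ 2).
Proof. by move=> bg; apply: (blipM bg bg). Qed.

Lemma blip_sum (I : Type) (s : seq I) (F : I -> 'rV[R]_m -> R) :
  (forall i, blip (F i)) -> blip (fun x => \sum_(i <- s) F i x).
Proof.
move=> bF; elim: s => [|i s IH].
  by under eq_fun do rewrite big_nil; exact: blip_cst.
by under eq_fun do rewrite big_cons; exact: blipD.
Qed.

Lemma cube_integral_sum (I : Type) (s : seq I) (F : I -> 'rV[R]_m -> R) :
  (forall i, blip (F i)) ->
  cube_integral (fun x => \sum_(i <- s) F i x) = \sum_(i <- s) cube_integral (F i).
Proof.
move=> bF; elim: s => [|i s IH].
  by under cube_integral_ext do rewrite big_nil; rewrite cube_integral_cst mulr0 big_nil.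
under cube_integral_ext do rewrite big_cons.
by rewrite cube_integralD ?IH ?big_cons//; exact: blip_sum.
Qed.

Lemma cube_integralB g h : blip g -> blip h ->
  cube_integral (fun x => g x - h x) = cube_integral g - cube_integral h.
Proof.
move=> bg bh; rewrite cube_integralD//; last exact: blipN.
by congr (_ + _); rewrite -mulN1r -cube_integralZ//; apply: cube_integral_ext => x; rewrite mulN1r.
Qed.

Lemma blip_cos M u : lipschitz1 M u -> blip (fun x => cos (u x)).
Proof.
move=> lu; exists (1 + `|M|); split=> [x|x y].
  by apply: le_trans (cos_max _) _; rewrite lerDl.
apply: le_trans (cos_lipschitz _ _) _; apply: le_trans (lu _ _) _.
by apply: ler_wpM2r; [exact: norm1_ge0|apply: le_trans (ler_norm _) _; rewrite lerDr].
Qed.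

Lemma blip_sin M u : lipschitz1 M u -> blip (fun x => sin (u x)).
Proof.
move=> lu; exists (1 + `|M|); split=> [x|x y].
  by apply: le_trans (sin_max _) _; rewrite lerDl.
apply: le_trans (sin_lipschitz _ _) _; apply: le_trans (lu _ _) _.
by apply: ler_wpM2r; [exact: norm1_ge0|apply: le_trans (ler_norm _) _; rewrite lerDr].
Qed.

Lemma blip_shift g (z : 'rV[R]_m) : blip g -> blip (fun x => g (x + z)).
Proof.
move=> [M [b l]]; exists M; split=> [x|x y]; first exact: b.
by apply: le_trans (l _ _) _; rewrite opprD addrACA subrr addr0.
Qed.

Lemma kdotD k x y : kdot k (x + y) = kdot k x + kdot k y.
Proof. by rewrite /kdot -big_split; apply: eq_bigr => i _; rewrite mxE mulrDr. Qed.

Lemma kdotDl k (l : 'rV[int]_m) x : kdot (k + l) x = kdot k x + kdot l x.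
Proof.
by rewrite /kdot -big_split; apply: eq_bigr => i _; rewrite mxE intrD mulrDl.
Qed.

Lemma kdotNl k x : kdot (- k) x = - kdot k x.
Proof. by rewrite /kdot -sumrN; apply: eq_bigr => i _; rewrite mxE mulrNz mulNr. Qed.

Lemma kdotBl k (l : 'rV[int]_m) x : kdot (k - l) x = kdot k x - kdot l x.
Proof. by rewrite kdotDl kdotNl. Qed.

Lemma kdotN k x : kdot k (- x) = - kdot k x.
Proof. by rewrite /kdot -sumrN; apply: eq_bigr => i _; rewrite mxE mulrN. Qed.

Lemma kdotB k x y : kdot k (x - y) = kdot k x - kdot k y.
Proof. by rewrite kdotD kdotN. Qed.

Lemma kdot_unitv k c i : kdot k (c *: unitv R i) = (k 0 i)%:~R * c.
Proof.
rewrite /kdot (bigD1 i) //= big1 => [|j ji].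
  by rewrite !mxE !eqxx mulr1 addr0.
by rewrite !mxE (negbTE ji) andbF !mulr0.
Qed.

Lemma kdot_lipschitz k : lipschitz1 (\sum_i `|(k 0 i)%:~R|) (fun x => kdot k x).
Proof.
move=> x y; rewrite -kdotB mulr_suml; apply: le_trans (ler_norm_sum _ _ _) _.
apply: ler_sum => i _; rewrite normrM ler_wpM2l// /norm1 (bigD1 i) //= lerDl.
exact: sumr_ge0.
Qed.

Lemma lipschitz1_phase c k w g M : lipschitz1 M g ->
  lipschitz1 (`|c| * M + \sum_i `|(k 0 i)%:~R|) (fun x => c * g x - kdot k x + w).
Proof.
move=> lg x y.
have -> : c * g x - kdot k x + w - (c * g y - kdot k y + w) =
  c * (g x - g y) - (kdot k x - kdot k y) by ring.
apply: le_trans (ler_normB _ _) _; rewrite mulrDl normrM; apply: lerD.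
  by rewrite -mulrA ler_wpM2l.
exact: kdot_lipschitz.
Qed.

Lemma lipschitz1_kdot k w : lipschitz1 (\sum_i `|(k 0 i)%:~R|) (fun x => kdot k x + w).
Proof. by move=> x y; rewrite opprD addrACA subrr addr0; exact: kdot_lipschitz. Qed.

Lemma cos_kdot_periodic k w : torus_periodic (fun x : 'rV[R]_m => cos (kdot k x + w)).
Proof.
by move=> i x; rewrite kdotD kdot_unitv addrAC cosD2pi_int.
Qed.

(* Shifting the i-th coordinate by pi / k_i changes the sign of the integrand. *)
Lemma cube_integral_cos k w : cube_integral (fun x : 'rV[R]_m => cos (kdot k x + w)) =
  if k == 0 then V * cos w else 0.
Proof.
have bc := blip_cos (lipschitz1_kdot k w).
case: eqP => [->|/eqP k0].
  rewrite -cube_integral_cst; apply: cube_integral_ext => x; congr cos.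
  by rewrite /kdot big1 ?add0r// => i _; rewrite mxE mul0r.
have /existsP[i ki] : [exists i, k 0 i != 0].
  by apply: contraNT k0 => /existsPn H; apply/eqP/rowP => i; rewrite mxE; apply/eqP/negPn/H.
have := cube_integral_shift i (pi / (k 0 i)%:~R) bc (cos_kdot_periodic k w).
under cube_integral_ext do rewrite kdotD kdot_unitv mulrC divfK ?intr_eq0// addrAC cosDpi.
have -> : cube_integral (fun x => - cos (kdot k x + w)) =
    - cube_integral (fun x => cos (kdot k x + w)).
  by rewrite -mulN1r -cube_integralZ//; apply: cube_integral_ext => x; rewrite mulN1r.
lra.
Qed.

Lemma cube_integral_sin k : cube_integral (fun x : 'rV[R]_m => sin (kdot k x)) = 0.
Proof.
under cube_integral_ext do rewrite -cosBpihalf.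
by rewrite cube_integral_cos; case: eqP => // _; rewrite cosN cos_pihalf mulr0.
Qed.

End CubeIntegral.

(** * Fourier coefficients and differences *)

Section FourierCoefficients.
Variables (R : realType) (m : nat).
Implicit Types (u v : 'rV[R]_m -> R) (x : 'rV[R]_m) (c h : R) (k l : 'rV[int]_m) (A B :
  'rV[int]_m -> R).

Local Notation V := ((2 * pi) ^+ m : R).

(** With [coef_im], the real and imaginary parts of the integral of (u + i v) e^{-i(k,x)}, without
    the normalising factor (2 pi)^{-m}. *)
Definition coef_re u v k : R :=
  cube_integral (fun x => u x * cos (kdot k x) + v x * sin (kdot k x)).

Definition coef_im u v k : R :=
  cube_integral (fun x => v x * cos (kdot k x) - u x * sin (kdot k x)).

Definition coef_sqr u v k : R := coef_re u v k ^+ 2 + coef_im u v k ^+ 2.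

(** With [trig_im], the real and imaginary parts of the trigonometric polynomial with coefficients
    A_k + i B_k. *)
Definition trig_re (s : seq 'rV[int]_m) A B x : R :=
  \sum_(k <- s) (A k * cos (kdot k x) - B k * sin (kdot k x)).

Definition trig_im (s : seq 'rV[int]_m) A B x : R :=
  \sum_(k <- s) (A k * sin (kdot k x) + B k * cos (kdot k x)).

Lemma volume_gt0 : 0 < V.
Proof. by rewrite exprn_gt0// pi2_gt0. Qed.

Lemma blip_cos_kdot k : blip (fun x : 'rV[R]_m => cos (kdot k x)).
Proof. exact: blip_cos (kdot_lipschitz (R := R) k). Qed.

Lemma blip_sin_kdot k : blip (fun x : 'rV[R]_m => sin (kdot k x)).
Proof. exact: blip_sin (kdot_lipschitz (R := R) k). Qed.

Lemma blip_coef_re u v k : blip u -> blip v ->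
  blip (fun x => u x * cos (kdot k x) + v x * sin (kdot k x)).
Proof.
by move=> bu bv; apply: blipD; apply: blipM => //;
  [exact: blip_cos_kdot|exact: blip_sin_kdot].
Qed.

Lemma blip_coef_im u v k : blip u -> blip v ->
  blip (fun x => v x * cos (kdot k x) - u x * sin (kdot k x)).
Proof.
by move=> bu bv; apply: blipB; apply: blipM => //;
  [exact: blip_cos_kdot|exact: blip_sin_kdot].
Qed.

Lemma blip_trig_re s A B : blip (trig_re s A B).
Proof.
apply: blip_sum => k; apply: blipB; apply: blipZ;
  [exact: blip_cos_kdot|exact: blip_sin_kdot].
Qed.

Lemma blip_trig_im s A B : blip (trig_im s A B).
Proof.
apply: blip_sum => k; apply: blipD; apply: blipZ;
  [exact: blip_sin_kdot|exact: blip_cos_kdot].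
Qed.

Lemma trig_sqrE s A B x : trig_re s A B x ^+ 2 + trig_im s A B x ^+ 2 =
  \sum_(k <- s) \sum_(l <- s) ((A k * A l + B k * B l) * cos (kdot (k - l) x + 0) +
     (A k * B l - B k * A l) * sin (kdot (k - l) x)).
Proof.
rewrite !expr2 !big_distrlr -big_split; apply: eq_bigr => k _.
rewrite -big_split; apply: eq_bigr => l _ /=.
by rewrite addr0 kdotBl cosB sinB; ring.
Qed.

Lemma parseval s A B : uniq s ->
  cube_integral (fun x => trig_re s A B x ^+ 2 + trig_im s A B x ^+ 2) =
  V * \sum_(k <- s) (A k ^+ 2 + B k ^+ 2).
Proof.
move=> us; under cube_integral_ext do rewrite trig_sqrE.
have bl k l : blip (fun x => (A k * A l + B k * B l) * cos (kdot (k - l) x + 0) +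
     (A k * B l - B k * A l) * sin (kdot (k - l) x)).
  by apply: blipD; apply: blipZ; [exact: blip_cos (lipschitz1_kdot _ _)|exact: blip_sin_kdot].
rewrite cube_integral_sum; last by move=> k; exact: blip_sum.
rewrite mulr_sumr big_seq [RHS]big_seq; apply: eq_bigr => k ks.
rewrite cube_integral_sum// (bigD1_seq k)//= big1 => [|l lk].
  rewrite addr0 cube_integralD; last 2 first.
  - by apply: blipZ; exact: blip_cos (lipschitz1_kdot _ _).
  - by apply: blipZ; exact: blip_sin_kdot.
  rewrite !cube_integralZ; last 2 first.
  - exact: blip_sin_kdot.
  - exact: blip_cos (lipschitz1_kdot _ _).
  rewrite cube_integral_cos cube_integral_sin subrr eqxx cos0.
  by ring.
rewrite cube_integralD; last 2 first.
- by apply: blipZ; exact: blip_cos (lipschitz1_kdot _ _).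
- by apply: blipZ; exact: blip_sin_kdot.
rewrite !cube_integralZ; last 2 first.
- exact: blip_sin_kdot.
- exact: blip_cos (lipschitz1_kdot _ _).
rewrite cube_integral_cos cube_integral_sin subr_eq0 eq_sym (negbTE lk).
by rewrite !mulr0 addr0.
Qed.

(** Let f = u + i v and let P be the polynomial with the unnormalised coefficients of f on [s].
    Integrating |V f - P|^2 >= 0 gives V^2 I - 2 V S + V S >= 0, where I is the integral of |f|^2
    and S the sum on the left. *)
Lemma bessel s u v : uniq s -> blip u -> blip v ->
  \sum_(k <- s) coef_sqr u v k <= V * cube_integral (fun x => u x ^+ 2 + v x ^+ 2).
Proof.
move=> us bu bv.
pose P := trig_re s (coef_re u v) (coef_im u v).
pose Q := trig_im s (coef_re u v) (coef_im u v).
have bP : blip P by exact: blip_trig_re.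
have bQ : blip Q by exact: blip_trig_im.
have buv : blip (fun x => u x ^+ 2 + v x ^+ 2) by apply: blipD; exact: blip_sqr.
have bPQ : blip (fun x => P x ^+ 2 + Q x ^+ 2) by apply: blipD; exact: blip_sqr.
have bc : blip (fun x => u x * P x + v x * Q x) by apply: blipD; exact: blipM.
have cross : cube_integral (fun x => u x * P x + v x * Q x) = \sum_(k <- s) coef_sqr u v k.
  have E x : u x * P x + v x * Q x = \sum_(k <- s)
    (coef_re u v k * (u x * cos (kdot k x) + v x * sin (kdot k x)) +
     coef_im u v k * (v x * cos (kdot k x) - u x * sin (kdot k x))).
    rewrite !mulr_sumr -big_split; apply: eq_bigr => k _ /=; ring.
  under cube_integral_ext do rewrite E.
  rewrite cube_integral_sum => [|k]; last first.
    by apply: blipD; apply: blipZ; [exact: blip_coef_re|exact: blip_coef_im].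
  apply: eq_bigr => k _; rewrite cube_integralD; last 2 first.
  - by apply: blipZ; exact: blip_coef_re.
  - by apply: blipZ; exact: blip_coef_im.
  by rewrite !cube_integralZ; [rewrite -!expr2|exact: blip_coef_im|exact: blip_coef_re].
have pars : cube_integral (fun x => P x ^+ 2 + Q x ^+ 2) = V * \sum_(k <- s) coef_sqr u v k.
  exact: parseval.
have : cube_integral (fun _ : 'rV[R]_m => 0 : R) <= cube_integral (fun x =>
   V ^+ 2 * (u x ^+ 2 + v x ^+ 2) + ((- 2 * V) * (u x * P x + v x * Q x) + (P x ^+ 2 + Q x ^+ 2))).
  apply: le_cube_integral.
  - exact: blip_cst.
  - by apply: blipD; [exact: blipZ|apply: blipD => //; exact: blipZ].
  - move=> x; rewrite [leRHS](_ : _ = (V * u x - P x) ^+ 2 + (V * v x - Q x) ^+ 2); last by ring.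
    by rewrite addr_ge0// sqr_ge0.
rewrite cube_integral_cst cube_integralD; [|exact: blipZ|by apply: blipD => //; exact: blipZ].
rewrite cube_integralD//; last exact: blipZ.
rewrite !cube_integralZ// cross pars.
set I := cube_integral _; set S := \sum_(k <- s) _; have V0 := volume_gt0.
rewrite mulr0 (_ : _ + _ = V * (V * I - S)); last by ring.
by rewrite pmulr_rge0// subr_ge0.
Qed.

(** * Differences and their Fourier multipliers *)

Definition delta (i : 'I_m) h u : 'rV[R]_m -> R := fun x => u (x + h *: unitv R i) - u x.

Lemma blip_delta i h u : blip u -> blip (delta i h u).
Proof. by move=> bu; apply: blipB => //; exact: blip_shift. Qed.

Lemma periodic_delta i h u : torus_periodic u -> torus_periodic (delta i h u).
Proof. by move=> pu j x; rewrite /delta addrAC !pu. Qed.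

(** Translation invariance applied to [G], the real part of e^{i th} (u + i v) e^{-i(k,x)}: the
    translation by [h] produces the factor e^{-i th}, which cancels the first one. *)
Lemma coef_shift_re u v k i h : blip u -> blip v -> torus_periodic u -> torus_periodic v ->
  let th := (k 0 i)%:~R * h in
  coef_re (fun x => u (x + h *: unitv R i)) (fun x => v (x + h *: unitv R i)) k =
  cos th * coef_re u v k - sin th * coef_im u v k.
Proof.
move=> bu bv pu pv th.
have b1 := blip_coef_re k bu bv; have b2 := blip_coef_im k bu bv.
pose G x := cos th * (u x * cos (kdot k x) + v x * sin (kdot k x)) -
  sin th * (v x * cos (kdot k x) - u x * sin (kdot k x)).
have bG : blip G by apply: blipB; exact: blipZ.
have pG : torus_periodic G.
  move=> j x; rewrite /G pu pv kdotD kdot_unitv cosD2pi_int.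
  by rewrite -!cosBpihalf addrAC cosD2pi_int.
rewrite -!cube_integralZ// -cube_integralB; [|exact: blipZ|exact: blipZ].
rewrite -(cube_integral_shift i h bG pG); apply: cube_integral_ext => x.
rewrite /G kdotD kdot_unitv -/th cosD sinD.
have := cos2Dsin2 th; move: (cos th) (sin th) => a b ab.
rewrite [RHS](_ : _ = (a ^+ 2 + b ^+ 2) * (u (x + h *: unitv R i) * cos (kdot k x) + v (x + h *:
    unitv R i) * sin (kdot k x))); last by ring.
by rewrite ab mul1r.
Qed.

Lemma coef_shift_im u v k i h : blip u -> blip v -> torus_periodic u -> torus_periodic v ->
  let th := (k 0 i)%:~R * h in
  coef_im (fun x => u (x + h *: unitv R i)) (fun x => v (x + h *: unitv R i)) k =
  cos th * coef_im u v k + sin th * coef_re u v k.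
Proof.
move=> bu bv pu pv th.
have b1 := blip_coef_re k bu bv; have b2 := blip_coef_im k bu bv.
pose G x := cos th * (v x * cos (kdot k x) - u x * sin (kdot k x)) +
  sin th * (u x * cos (kdot k x) + v x * sin (kdot k x)).
have bG : blip G by apply: blipD; exact: blipZ.
have pG : torus_periodic G.
  move=> j x; rewrite /G pu pv kdotD kdot_unitv cosD2pi_int.
  by rewrite -!cosBpihalf addrAC cosD2pi_int.
rewrite -!cube_integralZ// -cube_integralD; [|exact: blipZ|exact: blipZ].
rewrite -(cube_integral_shift i h bG pG); apply: cube_integral_ext => x.
rewrite /G kdotD kdot_unitv -/th cosD sinD.
have := cos2Dsin2 th; move: (cos th) (sin th) => a b ab.
rewrite [RHS](_ : _ = (a ^+ 2 + b ^+ 2) * (v (x + h *: unitv R i) * cos (kdot k x) - u (x + h *: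
    unitv R i) * sin (kdot k x))); last by ring.
by rewrite ab mul1r.
Qed.

Lemma coef_reB u v u' v' k : blip u -> blip v -> blip u' -> blip v' ->
  coef_re (fun x => u x - u' x) (fun x => v x - v' x) k = coef_re u v k - coef_re u' v' k.
Proof.
move=> bu bv bu' bv'; rewrite -cube_integralB; try exact: blip_coef_re.
by apply: cube_integral_ext => x; ring.
Qed.

Lemma coef_imB u v u' v' k : blip u -> blip v -> blip u' -> blip v' ->
  coef_im (fun x => u x - u' x) (fun x => v x - v' x) k = coef_im u v k - coef_im u' v' k.
Proof.
move=> bu bv bu' bv'; rewrite -cube_integralB; try exact: blip_coef_im.
by apply: cube_integral_ext => x; ring.
Qed.

(** The multiplier is |e^{i th} - 1|^2 with th = k_i h. *)
Lemma coef_sqr_delta u v k i h : blip u -> blip v -> torus_periodic u -> torus_periodic v ->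
  coef_sqr (delta i h u) (delta i h v) k =
  (2 - 2 * cos ((k 0 i)%:~R * h)) * coef_sqr u v k.
Proof.
move=> bu bv pu pv.
have bu' := blip_shift (h *: unitv R i) bu; have bv' := blip_shift (h *: unitv R i) bv.
rewrite /coef_sqr coef_reB// coef_imB// coef_shift_re// coef_shift_im//.
have := cos2Dsin2 ((k 0 i)%:~R * h); move: (cos _) (sin _) => a b ab.
move: (coef_re _ _ _) (coef_im _ _ _) => p q.
rewrite (_ : _ + _ = (a ^+ 2 + b ^+ 2 + 1 - 2 * a) * (p ^+ 2 + q ^+ 2)); last by ring.
by rewrite ab; ring.
Qed.

Lemma coef_sqr_iter_delta n u v k i h : blip u -> blip v -> torus_periodic u -> torus_periodic v ->
  coef_sqr (iter n (delta i h) u) (iter n (delta i h) v) k =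
  (2 - 2 * cos ((k 0 i)%:~R * h)) ^+ n * coef_sqr u v k.
Proof.
elim: n u v => [|n IH] u v bu bv pu pv; first by rewrite mul1r.
rewrite !iterSr IH; [|exact: blip_delta|exact: blip_delta|exact: periodic_delta|exact:
    periodic_delta].
by rewrite coef_sqr_delta// exprSr mulrA.
Qed.

Lemma coef_sqr_ge0 u v k : 0 <= coef_sqr u v k.
Proof. by rewrite addr_ge0// sqr_ge0. Qed.

Lemma bessel_bound s u v D : uniq s -> blip u -> blip v ->
  (forall x, `|u x| <= D) -> (forall x, `|v x| <= D) ->
  \sum_(k <- s) coef_sqr u v k <= V ^+ 2 * (2 * D ^+ 2).
Proof.
move=> us bu bv uD vD; apply: le_trans (bessel us bu bv) _.
rewrite expr2 -mulrA ler_wpM2l ?(ltW volume_gt0)// -cube_integral_cst.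
have D0 : 0 <= D by exact: le_trans (uD 0).
apply: le_cube_integral; [by apply: blipD; exact: blip_sqr|exact: blip_cst|].
move=> x; rewrite mulr_natl mulr2n; apply: lerD.
  by rewrite -real_normK ?num_real// lerXn2r// nnegrE.
by rewrite -real_normK ?num_real// lerXn2r// nnegrE.
Qed.

(** Where cos (k_i h) <= 0 the multiplier of one difference is at least 2, so the coefficients of
    the n-th difference dominate those of the function, and Bessel's inequality applies to the
    former. *)
Lemma bessel_delta s u v i h n D : uniq s -> blip u -> blip v ->
  torus_periodic u -> torus_periodic v ->
  (forall x, `|iter n (delta i h) u x| <= D) -> (forall x, `|iter n (delta i h) v x| <= D) ->
  (forall k, k \in s -> cos ((k 0 i)%:~R * h) <= 0) ->
  \sum_(k <- s) coef_sqr u v k <= V ^+ 2 * (2 * D ^+ 2).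
Proof.
move=> us bu bv pu pv uD vD ch.
have bi w : blip w -> blip (iter n (delta i h) w).
  by elim: n w {uD vD} => // n IH w bw; rewrite iterS; apply: blip_delta; exact: IH.
apply: le_trans (bessel_bound us (bi _ bu) (bi _ bv) uD vD).
rewrite big_seq [leRHS]big_seq; apply: ler_sum => k /ch kc.
rewrite coef_sqr_iter_delta// ler_peMl ?coef_sqr_ge0//.
by apply: exprn_ege1; lra.
Qed.

End FourierCoefficients.

(** * Functions with uniformly bounded derivatives *)

Section HolderClass.
Variables (R : realType) (a : R).
Hypotheses (a_ge0 : 0 <= a) (a_le1 : a <= 1).
Implicit Types (u v du : R -> R) (M h s t : R) (n : nat).

(** A quantitative C^{n,a}: one constant bounds the function, its derivatives up to order n and the
    last seminorm. For a = 0, as [powR] has 0^0 = 1, the seminorm condition only bounds the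
    oscillation, so the class C^nu is treated together with the others. *)
Fixpoint holder_class n M u : Prop := (forall t, `|u t| <= M) /\
  match n with
  | 0 => forall s t, `|u s - u t| <= M * `|s - t| `^ a
  | n'.+1 => exists du, (forall t : R, is_derive t 1 u (du t)) /\ holder_class n' M du
  end.

Lemma holder_class_bound n M u : holder_class n M u -> forall t, `|u t| <= M.
Proof. by case: n => [|n] []. Qed.

Lemma holder_class_ge0 n M u : holder_class n M u -> 0 <= M.
Proof. by move=> /holder_class_bound /(_ 0); exact: le_trans. Qed.

Lemma holder_class_le n M M' u : M <= M' -> holder_class n M u -> holder_class n M' u.
Proof.
move=> MM'; elim: n u => [|n IH] u [b H]; split; try by move=> t; exact: le_trans MM'.
  by move=> s t; apply: le_trans (H s t) _; rewrite ler_wpM2r ?powR_ge0.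
by case: H => du [d H]; exists du; split=> //; exact: IH.
Qed.

(** For |s - t| <= 1 one has |s - t| <= |s - t|^a since a <= 1; for larger distances the sup bound 2
    M is enough. *)
Lemma lipschitz_holder M u : (forall t, `|u t| <= M) ->
  (forall s t, `|u s - u t| <= M * `|s - t|) -> holder_class 0 (2 * M) u.
Proof.
move=> b l; have M0 : 0 <= M by exact: le_trans (b 0).
split=> [t|s t]; first by apply: le_trans (b t) _; lra.
have [st|st] := leP `|s - t| 1.
  apply: le_trans (l s t) _; apply: ler_pM => //; first by rewrite ler_peMl// ler1n.
  case: (eqVneq `|s - t| 0) => [->|n0]; first exact: powR_ge0.
  by apply: ger1_powR => //; rewrite lt_def n0 normr_ge0.
have p1 : 1 <= `|s - t| `^ a by rewrite -[leLHS](powRr0 `|s - t|) ler_powR// ltW.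
apply: le_trans (ler_normB _ _) _.
rewrite mulr_natl mulr2n mulrDl; apply: lerD; apply: le_trans (b _) _; rewrite ler_peMr//.
Qed.

Lemma derive_holder M u du : (forall t, `|u t| <= M) -> (forall t, is_derive t 1 u (du t)) ->
  (forall t, `|du t| <= M) -> holder_class 0 (2 * M) u.
Proof.
by move=> b d db; apply: lipschitz_holder => // s t; exact: derive_bounded_lipschitz d db s t.
Qed.

Lemma holder_class_lower n M u : holder_class n.+1 M u -> holder_class n (2 * M) u.
Proof.
elim: n u => [|n IH] u [b [du [d H]]].
  exact: derive_holder b d H.1.
split; last by exists du; split=> //; exact: IH.
move=> t; apply: le_trans (b t) _; have : 0 <= M by exact: le_trans (b 0).
lra.
Qed.

Lemma holder_classD n M M' u v : holder_class n M u -> holder_class n M' v ->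
  holder_class n (M + M') (fun t => u t + v t).
Proof.
elim: n u v => [|n IH] u v [b H] [b' H'].
  split=> [t|s t]; first by apply: le_trans (ler_normD _ _) _; apply: lerD.
  rewrite opprD addrACA mulrDl; apply: le_trans (ler_normD _ _) _; exact: lerD.
split=> [t|]; first by apply: le_trans (ler_normD _ _) _; apply: lerD.
case: H H' => [du [d H]] [dv [d' H']]; exists (fun t => du t + dv t); split; last exact: IH.
by move=> t; apply: is_deriveD.
Qed.

Lemma holder_classN n M u : holder_class n M u -> holder_class n M (fun t => - u t).
Proof.
elim: n u => [|n IH] u [b H].
  by split=> [t|s t]; rewrite -?opprD normrN.
split=> [t|]; first by rewrite normrN.
case: H => [du [d H]]; exists (fun t => - du t); split; last exact: IH.
by move=> t; apply: is_deriveN.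
Qed.

(** Leibniz rule, each undifferentiated factor being lowered by one order. [K] is chosen before the
    functions: this is what later keeps the bounds uniform in [lambda] and in the base point. *)
Lemma holder_classM n M M' : exists K, forall u v,
  holder_class n M u -> holder_class n M' v -> holder_class n K (fun t => u t * v t).
Proof.
elim: n M M' => [|n IH] M M'.
  exists (2 * (M * M')) => u v Hu Hv; have M0 := holder_class_ge0 Hu;
    have M'0 := holder_class_ge0 Hv.
  case: Hu Hv => [b H] [b' H']; split=> [t|s t].
    rewrite normrM; apply: (@le_trans _ _ (M * M')); first exact: ler_pM.
    by rewrite mulr_natl mulr2n lerDl mulr_ge0.
  have -> : u s * v s - u t * v t = u s * (v s - v t) + v t * (u s - u t) by ring.
  apply: le_trans (ler_normD _ _) _; rewrite !normrM.
  rewrite mulr_natl mulr2n mulrDl; apply: lerD.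
    by rewrite -mulrA; apply: ler_pM.
  by rewrite [M * M']mulrC -mulrA; apply: ler_pM.
have [K1 H1] := IH M (2 * M'); have [K2 H2] := IH (2 * M) M'.
exists (`|M * M'| + (`|K1| + `|K2|)) => u v Hu Hv.
have [b [du [d Hdu]]] := Hu; have [b' [dv [d' Hdv]]] := Hv.
split=> [t|].
  rewrite normrM; apply: (@le_trans _ _ (M * M')); first exact: ler_pM.
  by apply: le_trans (ler_norm _) _; rewrite lerDl addr_ge0.
exists (fun t => u t * dv t + v t * du t); split=> [t|].
  exact: (@is_deriveM _ _ u v).
have A1 := H1 _ _ Hdu (holder_class_lower Hv).
have A2 := H2 _ _ (holder_class_lower Hu) Hdv.
apply: (@holder_class_le _ (K2 + K1)).
  by rewrite addrC; apply: le_trans (lerD (ler_norm _) (ler_norm _)) _; rewrite lerDr.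
apply: holder_classD A2 _.
by under eq_fun do rewrite mulrC.
Qed.

Lemma is_derive_cos_comp u du t : is_derive t 1 u (du t) ->
  is_derive t 1 (fun t => cos (u t)) (- sin (u t) * du t).
Proof. by move=> d; apply: (@is_derive1_comp R cos u). Qed.

Lemma is_derive_sin_comp u du t : is_derive t 1 u (du t) ->
  is_derive t 1 (fun t => sin (u t)) (cos (u t) * du t).
Proof. by move=> d; apply: (@is_derive1_comp R sin u). Qed.

(** Only the derivative of [u] is controlled, because lambda * phi itself is not bounded uniformly
    in [lambda]. The inner claim [step] loses one order, which makes its induction close; one more
    differentiation recovers it. *)
Lemma holder_class_cos_sin n M : exists K, forall u du,
  (forall t, is_derive t 1 u (du t)) -> holder_class n M du ->
  holder_class n.+1 K (fun t => cos (u t)) /\ holder_class n.+1 K (fun t => sin (u t)).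
Proof.
have step : exists K, forall u du, (forall t, is_derive t 1 u (du t)) -> holder_class n M du ->
    holder_class n K (fun t => cos (u t)) /\ holder_class n K (fun t => sin (u t)).
  elim: n M => [|n IH] M.
    exists (2 * (1 + `|M|)) => u du d [b _].
    have b1 t : `|du t| <= 1 + `|M| by apply: le_trans (b t) _; apply: le_trans (ler_norm _) _;
        rewrite lerDr.
    have l := derive_bounded_lipschitz d b1.
    split; apply: lipschitz_holder => [t|s t].
    - by apply: le_trans (cos_max _) _; rewrite lerDl.
    - exact: le_trans (cos_lipschitz _ _) (l s t).
    - by apply: le_trans (sin_max _) _; rewrite lerDl.
    - exact: le_trans (sin_lipschitz _ _) (l s t).
  have [K0 H0] := IH (2 * M); have [K1 H1] := holder_classM n K0 (2 * M).
  exists (1 + `|K1|) => u du d Hdu; have Hl := holder_class_lower Hdu.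
  have [Hc Hs] := H0 u du d Hl.
  have Kle : K1 <= 1 + `|K1| by apply: le_trans (ler_norm _) _; rewrite lerDr.
  split; split.
  - by move=> t; apply: le_trans (cos_max _) _; rewrite lerDl.
  - exists (fun t => - sin (u t) * du t); split; first by move=> t; exact: is_derive_cos_comp.
    by apply: (holder_class_le Kle); apply: H1 Hl; exact: holder_classN.
  - by move=> t; apply: le_trans (sin_max _) _; rewrite lerDl.
  - exists (fun t => cos (u t) * du t); split; first by move=> t; exact: is_derive_sin_comp.
    by apply: (holder_class_le Kle); exact: H1 Hl.
have [K0 H0] := step; have [K1 H1] := holder_classM n K0 M.
exists (1 + `|K1|) => u du d Hdu; have [Hc Hs] := H0 u du d Hdu.
have Kle : K1 <= 1 + `|K1| by apply: le_trans (ler_norm _) _; rewrite lerDr.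
split; split.
- by move=> t; apply: le_trans (cos_max _) _; rewrite lerDl.
- exists (fun t => - sin (u t) * du t); split; first by move=> t; exact: is_derive_cos_comp.
  by apply: (holder_class_le Kle); apply: H1 Hdu; exact: holder_classN.
- by move=> t; apply: le_trans (sin_max _) _; rewrite lerDl.
- exists (fun t => cos (u t) * du t); split; first by move=> t; exact: is_derive_sin_comp.
  by apply: (holder_class_le Kle); exact: H1 Hdu.
Qed.

Definition difference h u : R -> R := fun t => u (t + h) - u t.

Lemma is_derive_iter_difference n h u du : (forall t, is_derive t 1 u (du t)) ->
  forall t, is_derive t 1 (iter n (difference h) u) (iter n (difference h) du t).
Proof.
move=> d; elim: n => //= n IH t.
by apply: is_deriveB; apply: is_derive_shift; exact: IH.
Qed.

(** Each derivative pays for one difference through the mean value theorem, and the last difference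
    is paid by the Hoelder condition. *)
Lemma holder_class_difference n M u h t : holder_class n M u -> 0 <= h ->
  `|iter n.+1 (difference h) u t| <= M * (h ^+ n * h `^ a).
Proof.
move=> + h0; elim: n u t => [|n IH] u t [b H].
  rewrite mul1r; apply: le_trans (H _ _) _.
  by rewrite addrAC subrr add0r ger0_norm.
case: H => du [d H]; rewrite iterS /difference.
have D s := is_derive_iter_difference n.+1 h d s.
apply: le_trans (derive_bounded_lipschitz D (fun s => IH du s H) _ _) _.
by rewrite addrAC subrr add0r (ger0_norm h0) exprS le_eqVlt; apply/orP; left; apply/eqP; ring.
Qed.

End HolderClass.

(** * Regularity of the phase *)

Section Regularity.
Variables (R : realType) (m : nat).
Implicit Types (f g : 'rV[R]_m -> R) (x y v : 'rV[R]_m) (c t : R) (i j : 'I_m) (s : seq 'I_m).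

Definition lattice_vector (z : 'I_m -> int) : 'rV[R]_m :=
  \sum_i ((z i)%:~R * (2 * pi)) *: unitv R i.

Lemma lattice_vectorE z i : lattice_vector z 0 i = (z i)%:~R * (2 * pi).
Proof.
rewrite /lattice_vector summxE (bigD1 i) //= big1 => [|j ji].
  by rewrite !mxE !eqxx mulr1 addr0.
by rewrite !mxE eq_sym (negbTE ji) andbF mulr0.
Qed.

Lemma periodic_lattice g z x : torus_periodic g -> g (x + lattice_vector z) = g x.
Proof.
move=> pg.
have pos (n : nat) i y : g (y + (n%:R * (2 * pi)) *: unitv R i) = g y.
  elim: n y => [|n IH] y; first by rewrite mul0r scale0r addr0.
  by rewrite -natr1 mulrDl mul1r scalerDl addrA pg IH.
have int1 (n : int) i y : g (y + (n%:~R * (2 * pi)) *: unitv R i) = g y.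
  case: n => n; first by rewrite -pmulrn pos.
  rewrite NegzE mulrNz -pmulrn -[LHS](pos n.+1 i); congr g.
  by rewrite mulNr scaleNr subrK.
rewrite /lattice_vector; elim: (index_enum _) x => [|i s IH] x.
  by rewrite big_nil addr0.
by rewrite big_cons addrA IH int1.
Qed.

Lemma lattice_reduction x : exists z, forall i, - pi <= (x + lattice_vector z) 0 i <= pi.
Proof.
exists (fun i => - Num.floor ((x 0 i + pi) / (2 * pi))) => i.
rewrite mxE lattice_vectorE mulrNz mulNr.
have p0 := pi2_gt0 R.
have := Num.Theory.floor_itv ((x 0 i + pi) / (2 * pi)) => /andP[].
rewrite ler_pdivlMr// ltr_pdivrMr//; move: (Num.floor _) => n.
have E (w y q : R) : w <= y + q -> y + q < w + 2 * q -> - q <= y - w <= q.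
  by move=> ? ?; apply/andP; split; lra.
move=> a b; apply: E; first exact: a.
by apply: lt_le_trans b _; rewrite intrD mulrDl [1%:~R * _]mul1r.
Qed.

Lemma periodic_bounded g : continuous g -> torus_periodic g -> exists M, forall x, `|g x| <= M.
Proof.
move=> cg pg; pose A := [set x : 'rV[R]_m | forall i, `[- pi, pi]%classic (x 0 i)].
have cA : compact A := @rV_compact R m _ (fun=> @segment_compact R (- pi) pi).
have cg' : {within A, continuous g} by exact: continuous_subspaceT.
have [M [_ HM]] := compact_bounded (continuous_compact cg' cA).
exists (M + 1) => x; have [z zP] := lattice_reduction x.
rewrite -(periodic_lattice z x pg); apply: (HM (M + 1)); first by rewrite ltrDl.
by exists (x + lattice_vector z) => //= i; rewrite in_itv /= zP.
Qed.

Lemma periodic_partial i f : torus_periodic f -> torus_periodic (partial i f).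
Proof.
move=> pf j x; rewrite /partial /derive pf.
suff -> : f \o shift (x + (2 * pi) *: unitv R j) = f \o shift x by [].
by apply/funext => h /=; rewrite addrA pf.
Qed.

Lemma periodic_iter_partial s f : torus_periodic f -> torus_periodic (iter_partial s f).
Proof. by move=> pf; elim: s => //= i s IH; exact: periodic_partial. Qed.

Lemma derive_sum f x v : differentiable f x -> 'D_v f x = \sum_i v 0 i * partial i f x.
Proof.
move=> df; rewrite deriveE// [in LHS](row_sum_delta v) linear_sum.
by apply: eq_bigr => i _; rewrite linearZ /= /partial deriveE.
Qed.

Lemma is_derive_line f x v t : differentiable f (x + t *: v) ->
  is_derive t 1 (fun t => f (x + t *: v)) ('D_v f (x + t *: v)).
Proof.
move=> df; have dv := @diff_derivable _ _ _ f (x + t *: v) v df.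
have E : (fun h : R => h^-1 *: (f (x + (h *: (1 : R) + t) *: v) - f (x + t *: v))) =
         (fun h : R => h^-1 *: (f (h *: v + (x + t *: v)) - f (x + t *: v))).
  apply/funext => h; congr (_ *: (f _ - _)).
  by rewrite [h *: 1]mulr1 scalerDl addrCA.
split; first by rewrite /derivable E; exact: dv.
by rewrite /derive E.
Qed.

Lemma le_norm1 v i : `|v 0 i| <= norm1 v.
Proof. by rewrite /norm1 (bigD1 i)//= lerDl sumr_ge0. Qed.

Lemma norm_le_norm1 v : `|v| <= norm1 v.
Proof.
rewrite [leLHS]/Num.norm /= mx_normrE; apply/bigmax_leP; split; first exact: norm1_ge0.
by move=> [i j] _ /=; rewrite (ord1 i); exact: le_norm1.
Qed.

Lemma bounded_partial_lipschitz f M : (forall x, differentiable f x) ->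
  (forall i x, `|partial i f x| <= M) -> lipschitz1 M f.
Proof.
move=> df bM x y; pose v := x - y.
have D t := is_derive_line (df (y + t *: v)).
have [c _] := mean_value D (@ler01 R).
rewrite scale1r scale0r addr0 subr0 mulr1 subrKC => ->.
rewrite derive_sum// /norm1 mulr_sumr; apply: le_trans (ler_norm_sum _ _ _) _.
by apply: ler_sum => i _; rewrite normrM mulrC ler_wpM2r.
Qed.

(** The mean value theorem on the segment, with the gradient compared at its two positions; second
    derivatives need not exist, as in the case nu = alpha = 1. *)
Lemma lipschitz_gradient_taylor f L x v : (forall x, differentiable f x) ->
  0 <= L -> (forall i, lipschitz1 L (partial i f)) ->
  `|f (x + v) - f x - \sum_i v 0 i * partial i f x| <= L * norm1 v ^+ 2.
Proof.
move=> df L0 lf.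
have D t := is_derive_line (df (x + t *: v)).
have [c /andP[c0 c1]] := mean_value D (@ler01 R).
rewrite scale1r scale0r addr0 subr0 mulr1 => ->.
rewrite derive_sum// -sumrB expr2 mulrA mulrC /norm1 mulr_suml.
apply: le_trans (ler_norm_sum _ _ _) _; apply: ler_sum => i _.
rewrite -mulrBr normrM ler_wpM2l//; apply: le_trans (lf i _ _) _.
rewrite ler_wpM2l// addrAC subrr add0r; apply: ler_sum => j _.
by rewrite mxE normrM ger0_norm// ler_piMl.
Qed.

Lemma holder_continuous (alpha : R) f : 0 < alpha -> holder alpha f -> continuous f.
Proof.
move=> a0 [C HC] x; have F : Filter (nbhs x) := nbhs_filter x.
apply/(@cvgrPdist_lt _ _ _ (nbhs x)) => e e0.
have C1 : 0 < `|C| + 1 by rewrite ltr_wpDl.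
pose d := (e / (`|C| + 1)) `^ alpha^-1.
have d0 : 0 < d by rewrite powR_gt0// divr_gt0.
near=> y; apply: le_lt_trans (HC x y) _.
have xy : `|x - y| < d by near: y; apply: cvgr_dist_lt.
have : `|x - y| `^ alpha < e / (`|C| + 1).
  rewrite -[ltRHS](_ : d `^ alpha = _).
    by apply: gt0_ltr_powR; rewrite ?nnegrE// ltW.
  by rewrite /d -powRrM mulVf ?gt_eqF// powRr1// ltW// divr_gt0.
rewrite ltr_pdivlMr// => H; apply: le_lt_trans H.
rewrite mulrC ler_wpM2l ?powR_ge0//; have := ler_norm C; lra.
Unshelve. all: by end_near. Qed.

(** * Consequences of the regularity hypothesis *)

Section SmoothPhase.
Variables (nu : nat) (alpha : R) (phi : 'rV[R]_m -> R).
Hypotheses (alpha_ge0 : 0 <= alpha) (alpha_le1 : alpha <= 1)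
  (per : torus_periodic phi) (smooth : C_nu_alpha nu alpha phi)
  (order_ge2 : 2 <= nu%:R + alpha).

Lemma nu_gt0 : (0 < nu)%N.
Proof.
rewrite lt0n; apply: contraTN isT => /eqP nu0.
by move: (order_ge2); rewrite nu0 add0r => /le_trans/(_ alpha_le1); rewrite (ler_nat R 2 1).
Qed.

Lemma iter_partial_continuous s : (size s <= nu)%N -> continuous (iter_partial s phi).
Proof.
case: smooth => sd sc; rewrite leq_eqVlt => /predU1P[/sc|/sd ds x]; last first.
  exact: differentiable_continuous.
case: eqP => // /eqP a0; apply: holder_continuous.
by rewrite lt_def a0.
Qed.

Lemma iter_partial_bounded s : (size s <= nu)%N ->
  exists M, forall x, `|iter_partial s phi x| <= M.
Proof.
by move=> /iter_partial_continuous cs; apply: periodic_bounded => //; exact: periodic_iter_partial.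
Qed.

Lemma phase_differentiable x : differentiable phi x.
Proof. by case: smooth => /(_ [::] nu_gt0 x). Qed.

Lemma phase_partial_bounded : exists2 M, 0 <= M & forall i x, `|partial i phi x| <= M.
Proof.
have H i : exists M, forall x, `|partial i phi x| <= M.
  by have := @iter_partial_bounded [:: i] nu_gt0.
have [M MP] := choice H.
exists (\sum_i `|M i|); first exact: sumr_ge0.
move=> i x; apply: le_trans (MP i x) _; apply: le_trans (ler_norm _) _.
by rewrite (bigD1 i)//= lerDl sumr_ge0.
Qed.

Lemma phase_lipschitz : exists2 M, 0 <= M & lipschitz1 M phi.
Proof.
have [M M0 HM] := phase_partial_bounded; exists M => //.
by apply: bounded_partial_lipschitz => //; exact: phase_differentiable.
Qed.

(** If nu >= 2, the second derivatives are continuous and periodic, hence bounded. Otherwise nu +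
    alpha >= 2 forces nu = alpha = 1, and the Hoelder condition is the claim. *)
Lemma gradient_lipschitz : exists2 L, 0 <= L & forall i, lipschitz1 L (partial i phi).
Proof.
have [nu2|] := leqP 2 nu.
  have H (ij : 'I_m * 'I_m) : exists M, forall x, `|partial ij.1 (partial ij.2 phi) x| <= M.
    by have := @iter_partial_bounded [:: ij.1; ij.2] nu2.
  have [M MP] := choice H.
  exists (\sum_ij `|M ij|); first exact: sumr_ge0.
  move=> i; apply: bounded_partial_lipschitz.
    by case: smooth => /(_ [:: i] nu2).
  move=> j x; apply: le_trans (MP (j, i) x) _; apply: le_trans (ler_norm _) _.
  by rewrite (bigD1 (j, i))//= lerDl sumr_ge0.
have := nu_gt0; case: nu smooth order_ge2 => [//|[|//]] [_ sc] o2 _ _.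
have a1 : alpha = 1 by apply/le_anti; rewrite alpha_le1 /= -(lerD2l 1).
have H i : exists M, forall x y, `|partial i phi x - partial i phi y| <= M * `|x - y|.
  have := sc [:: i] erefl; rewrite a1 oner_eq0 => -[M HM]; exists M => x y.
  by have := HM x y; rewrite powRr1.
have [M MP] := choice H.
exists (\sum_i `|M i|); first exact: sumr_ge0.
move=> i x y; apply: le_trans (MP i x y) _.
apply: (@le_trans _ _ (`|M i| * `|x - y|)); first by rewrite ler_wpM2r// ler_norm.
apply: ler_pM => //; last exact: norm_le_norm1.
by rewrite (bigD1 i)//= lerDl sumr_ge0.
Qed.

Lemma norm_unitv i : `|unitv R i| = 1 :> R.
Proof.
apply/le_anti/andP; split.
  have := norm_le_norm1 (1 *: unitv R i); rewrite norm1_unitv scale1r normr1.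
  exact.
rewrite [leRHS]/Num.norm /= mx_normrE; apply/bigmax_geP; right; exists (0, i) => //=.
by rewrite mxE !eqxx normr1.
Qed.

(** Differentiating along the line of speed [r] multiplies the prefactor [c0] by [r], so quantifying
    over all |c0| <= 1 and r <= 1 makes the induction on the remaining order close. The order starts
    at 1, since lambda * phi has no uniform bound. *)
Lemma pure_derivative_class i l : (l < nu)%N -> exists M, forall x (c0 r : R),
  `|c0| <= 1 -> 0 < r <= 1 ->
  holder_class alpha (nu - l.+1) M
    (fun t => c0 * iter_partial (nseq l.+1 i) phi (x + (t * r) *: unitv R i)).
Proof.
move=> lnu; have [n Hn] : exists n, (nu - l.+1)%N = n by exists (nu - l.+1)%N.
rewrite Hn; elim: n l lnu Hn => [|n IH] l lnu Hn.
  have lE : l.+1 = nu by lia.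
  have [M HM] := @iter_partial_bounded (nseq l.+1 i) ltac:(by rewrite size_nseq).
  have M0 : 0 <= M by exact: le_trans (HM 0).
  case: smooth => _ /(_ (nseq l.+1 i)); rewrite size_nseq => /(_ lE).
  have bnd K x c0 r : M <= K -> `|c0| <= 1 -> forall t,
      `|c0 * iter_partial (nseq l.+1 i) phi (x + (t * r) *: unitv R i)| <= K.
    by move=> MK c1 t; rewrite normrM; apply: le_trans MK; rewrite -[leRHS]mul1r; apply: ler_pM.
  case: eqP => [a0 _|_ [C HC]].
    exists (2 * M) => x c0 r c1 r1; split=> [|s t]; first by apply: bnd => //; lra.
    rewrite a0 powRr0 mulr1 -mulrBr normrM; apply: (@le_trans _ _ (1 * (M + M))).
      by apply: ler_pM => //; apply: le_trans (ler_normB _ _) _; apply: lerD.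
    by rewrite mul1r mulr_natl mulr2n.
  exists (M + `|C|) => x c0 r c1 /andP[r0 r1]; split=> [|s t].
    by apply: bnd => //; rewrite lerDl.
  rewrite -mulrBr normrM -[leRHS]mul1r; apply: ler_pM => //.
  apply: le_trans (HC _ _) _; rewrite opprD addrACA subrr add0r -scalerBl -mulrBl normrZ
      norm_unitv mulr1.
  apply: ler_pM; rewrite ?powR_ge0//.
  (* The Hoelder condition at two points of distance 1 shows C >= 0. *)
  - by have := HC 0 (unitv R i); rewrite sub0r normrN norm_unitv powR1 mulr1; exact: le_trans.
  - by apply: le_trans (ler_norm _) _; rewrite lerDr.
  - apply: ge0_ler_powR; rewrite ?nnegrE//.
    by rewrite normrM -[leRHS]mulr1 ler_wpM2l// gtr0_norm.
have lnu2 : (l.+1 < nu)%N by lia.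
have [M1 H1] := IH l.+1 lnu2 ltac:(lia).
have [M HM] := @iter_partial_bounded (nseq l.+1 i) ltac:(by rewrite size_nseq).
exists (`|M| + `|M1|) => x c0 r c1 r1; split=> [t|].
  rewrite normrM -[leRHS]mul1r; apply: ler_pM => //; apply: le_trans (HM _) _.
  by apply: le_trans (ler_norm _) _; rewrite lerDl.
exists (fun t => (c0 * r) * iter_partial (nseq l.+2 i) phi (x + (t * r) *: unitv R i)).
split; last first.
  apply: (@holder_class_le _ alpha _ M1); first by apply: le_trans (ler_norm _) _; rewrite lerDr.
  apply: H1 => //; case/andP: r1 => r0 r1; rewrite normrM -[leRHS]mul1r.
  by apply: ler_pM => //; rewrite gtr0_norm.
move=> t; set g := iter_partial (nseq l.+1 i) phi.
have dg y : differentiable g y.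
  by case: smooth => sd _; apply: sd; rewrite size_nseq.
have D := is_derive_line (v := unitv R i) (dg (x + (t * r + 0) *: unitv R i)).
have := is_derive_affine D.
move=> /(@is_deriveZ _ _ _ _ c0) H.
rewrite (_ : (c0 * r) * _ = c0 *: ('D_(unitv R i) g (x + (t * r + 0) *: unitv R i) * r));
    last first.
  by rewrite addr0 /GRing.scale /= /g /partial; ring.
rewrite (_ : (fun t0 : R => _) = c0 \*: (fun t => g (x + (t * r + 0) *: unitv R i)));
    first exact: H.
by apply/funext => u /=; rewrite addr0.
Qed.

End SmoothPhase.
End Regularity.

(** * Mean square bounds on dyadic blocks *)

Section DyadicBlocks.
Variables (R : realType) (m : nat).
Implicit Types (x : 'rV[R]_m) (i : 'I_m) (k : 'rV[int]_m) (s : seq 'rV[int]_m).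
Variables (nu : nat) (alpha : R) (phi : 'rV[R]_m -> R).
Hypotheses (alpha_ge0 : 0 <= alpha) (alpha_le1 : alpha <= 1)
  (per : torus_periodic phi) (smooth : C_nu_alpha nu alpha phi)
  (order_ge2 : 2 <= nu%:R + alpha).

Local Notation V := ((2 * pi) ^+ m : R).

Lemma iter_delta_line n i (g : 'rV[R]_m -> R) x (h H r t : R) : H * r = h ->
  iter n (difference H) (fun t => g (x + (t * r) *: unitv R i)) t =
  iter n (delta i h) g (x + (t * r) *: unitv R i).
Proof.
move=> Hr; elim: n t => //= n IH t; rewrite /difference /delta !IH.
by rewrite mulrDl Hr scalerDl addrA.
Qed.

Lemma phase_delta_bound i : exists2 K, 0 <= K & forall (lambda h : R) x, 1 <= `|lambda| -> 0 <= h ->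
  `|iter nu.+1 (delta i h) (fun x => cos (lambda * phi x)) x| <=
     K * ((`|lambda| * h) ^+ nu * (`|lambda| * h) `^ alpha) /\
  `|iter nu.+1 (delta i h) (fun x => sin (lambda * phi x)) x| <=
     K * ((`|lambda| * h) ^+ nu * (`|lambda| * h) `^ alpha).
Proof.
have nu0 : (0 < nu)%N := nu_gt0 alpha_le1 order_ge2.
have [M HM] := pure_derivative_class alpha_ge0 alpha_le1 per smooth order_ge2 i nu0.
have [K HK] := holder_class_cos_sin alpha_ge0 alpha_le1 (nu - 1)%N M.
exists `|K| => // lambda h x l1 h0.
have l0 : 0 < `|lambda| by exact: lt_le_trans l1.
(* In the variable rescaled by [r] the phase [u] has derivative [du], whose prefactor [lambda * r]
   is a sign; a step [h] becomes [|lambda| * h]. The claim is then read off at t = 0. *)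
pose r : R := `|lambda|^-1.
pose u (t : R) : R := lambda * phi (x + (t * r) *: unitv R i).
pose du (t : R) : R := (lambda * r) * iter_partial [:: i] phi (x + (t * r) *: unitv R i).
have r01 : 0 < r <= 1 by rewrite invr_gt0 l0 invf_le1.
have Hdu : holder_class alpha (nu - 1) M du.
  by apply: (HM x) => //; rewrite normrM [`|r|]gtr0_norm ?invr_gt0// mulfV ?gt_eqF.
have D (t : R) : is_derive t 1 u (du t).
  have dp := phase_differentiable alpha_le1 smooth order_ge2 (x + (t * r + 0) *: unitv R i).
  have := is_derive_affine (is_derive_line dp) => /(@is_deriveZ _ _ _ _ lambda) DD.
  rewrite (_ : du t = lambda *: ('D_(unitv R i) phi (x + (t * r + 0) *: unitv R i) * r));
      last first.
    by rewrite addr0 /du /GRing.scale /= /partial; ring.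
  rewrite (_ : u = lambda \*: (fun t => phi (x + (t * r + 0) *: unitv R i))); first exact: DD.
  by apply/funext => t0 /=; rewrite addr0.
have [Hc Hs] := HK u du D Hdu.
have H0 : 0 <= `|lambda| * h by rewrite mulr_ge0.
have Hr : `|lambda| * h * r = h by rewrite mulrAC mulfV ?mul1r// gt_eqF.
have nuE : (nu - 1).+1 = nu by lia.
have C := holder_class_difference 0 Hc H0; have S := holder_class_difference 0 Hs H0.
rewrite nuE in C S.
have := @iter_delta_line nu.+1 i (fun x => cos (lambda * phi x)) x h _ r 0 Hr.
have := @iter_delta_line nu.+1 i (fun x => sin (lambda * phi x)) x h _ r 0 Hr.
rewrite mul0r scale0r addr0 => <- <-.
have KP : K * ((`|lambda| * h) ^+ nu * (`|lambda| * h) `^ alpha) <=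
          `|K| * ((`|lambda| * h) ^+ nu * (`|lambda| * h) `^ alpha).
  by rewrite ler_wpM2r ?ler_norm// mulr_ge0 ?exprn_ge0 ?powR_ge0.
by split; apply: le_trans KP.
Qed.

Lemma lipschitz1_scaled (c : R) : exists M, lipschitz1 M (fun x => c * phi x).
Proof.
have [M M0 HM] := phase_lipschitz alpha_ge0 alpha_le1 per smooth order_ge2.
exists (`|c| * M) => x y; rewrite -mulrBr normrM -mulrA ler_wpM2l//; exact: HM.
Qed.

Lemma blip_cos_phase (c : R) : blip (fun x => cos (c * phi x)).
Proof. by have [M HM] := lipschitz1_scaled c; exact: blip_cos HM. Qed.

Lemma blip_sin_phase (c : R) : blip (fun x => sin (c * phi x)).
Proof. by have [M HM] := lipschitz1_scaled c; exact: blip_sin HM. Qed.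

Lemma fourier_abs_sqr lambda k : fourier_abs lambda phi k ^+ 2 =
  V ^- 2 * coef_sqr (fun x => cos (lambda * phi x)) (fun x => sin (lambda * phi x)) k.
Proof.
rewrite /fourier_abs sqr_sqrtr ?addr_ge0 ?sqr_ge0//.
have re : fourier_re lambda phi k = V^-1 * coef_re (fun x => cos (lambda * phi x)) (fun x => sin
    (lambda * phi x)) k.
  by congr (_ * _); apply: cube_integral_ext => x; rewrite cosB.
have im : fourier_im lambda phi k = V^-1 * coef_im (fun x => cos (lambda * phi x)) (fun x => sin
    (lambda * phi x)) k.
  by congr (_ * _); apply: cube_integral_ext => x; rewrite sinB.
rewrite re im /coef_sqr; move: (coef_re _ _ _) (coef_im _ _ _) => a b.
by rewrite ![(_ ^- m * _) ^+ 2]exprMn -mulrDr exprVn.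
Qed.

Lemma fourier_abs_ge0 lambda k : 0 <= fourier_abs lambda phi k.
Proof. exact: sqrtr_ge0. Qed.

(** The constant 2 comes from bounding cosine and sine separately by 1. *)
Lemma l2_bound lambda s : uniq s -> \sum_(k <- s) fourier_abs lambda phi k ^+ 2 <= 2.
Proof.
move=> us; under eq_bigr do rewrite fourier_abs_sqr.
rewrite -mulr_sumr ler_pdivrMl ?exprn_gt0 ?pi2_gt0//.
rewrite [leRHS](_ : _ = V ^+ 2 * (2 * 1 ^+ 2)); last by rewrite expr1n mulr1.
apply: bessel_bound => //; [exact: blip_cos_phase|exact: blip_sin_phase| |].
- by move=> x; exact: cos_max.
- by move=> x; exact: sin_max.
Qed.

Lemma cos_half_period_le0 (y : R) : pi / 2 <= `|y| <= pi -> cos y <= 0.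
Proof.
move=> /andP[y1 y2]; rewrite -cos_norm.
have := @cos_ge0_pihalf R (pi - `|y|).
rewrite addrC cosDpi cosN oppr_ge0; apply.
have := pi_gt0 R; lra.
Qed.

Lemma dyadic_l2_bound : exists2 K, 0 < K & forall lambda j i s, 1 <= `|lambda| -> uniq s ->
  (forall k, k \in s -> (2 ^ j <= absz (k 0%R i) <= 2 ^ j.+1)%N) ->
  \sum_(k <- s) fourier_abs lambda phi k ^+ 2 <= K * (`|lambda| / 2 ^+ j) `^ (2 * (nu%:R + alpha)).
Proof.
have H i := phase_delta_bound i.
have /choice[K KP] : forall i, exists K, 0 <= K /\ forall (lambda h : R) x, 1 <= `|lambda| ->
    0 <= h ->
  `|iter nu.+1 (delta i h) (fun x => cos (lambda * phi x)) x| <=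
     K * ((`|lambda| * h) ^+ nu * (`|lambda| * h) `^ alpha) /\
  `|iter nu.+1 (delta i h) (fun x => sin (lambda * phi x)) x| <=
     K * ((`|lambda| * h) ^+ nu * (`|lambda| * h) `^ alpha).
  by move=> i; have [K0 K00 K1] := H i; exists K0.
have S0 : 0 <= \sum_i K i by apply: sumr_ge0 => i _; case: (KP i).
set b := nu%:R + alpha.
(* The sum removes the dependence on the direction and the 1 ensures positivity. The power of pi / 2
   appears because [|lambda| * h] equals (|lambda| / 2^j) (pi / 2) for the step [h] below. *)
exists (2 * (1 + \sum_i K i) ^+ 2 * (pi / 2) `^ (2 * b)).
  by rewrite !mulr_gt0 ?exprn_gt0 ?powR_gt0 ?divr_gt0 ?pi_gt0// ltr_pwDl.
move=> lambda j i s l1 us sj.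
have l0 : 0 < `|lambda| by exact: lt_le_trans l1.
(* With this step, 2^j <= |k_i| <= 2^(j+1) means pi / 2 <= |k_i h| <= pi, where the cosine is
   nonpositive. *)
pose h : R := pi / 2 ^+ j.+1.
have h0 : 0 < h by rewrite divr_gt0 ?pi_gt0 ?exprn_gt0.
pose D := K i * ((`|lambda| * h) ^+ nu * (`|lambda| * h) `^ alpha).
have [_ KD] := KP i.
under eq_bigr do rewrite fourier_abs_sqr.
rewrite -mulr_sumr ler_pdivrMl ?exprn_gt0 ?pi2_gt0//.
apply: le_trans (@bessel_delta R m s _ _ i h nu.+1 D us (blip_cos_phase lambda) (blip_sin_phase
    lambda) _ _ _ _ _) _.
- by move=> i' x; rewrite per.
- by move=> i' x; rewrite per.
- by move=> x; have [] := KD lambda h x l1 (ltW h0).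
- by move=> x; have [] := KD lambda h x l1 (ltW h0).
- move=> k /sj /andP[k1 k2]; apply: cos_half_period_le0.
  have kE : `|(k 0 i)%:~R : R| = (absz (k 0 i))%:R by rewrite -intr_norm -abszE -pmulrn.
  rewrite normrM kE (gtr0_norm h0) /h.
  have p0 := pi_gt0 R; have e0 : 0 < 2 ^+ j.+1 :> R by rewrite exprn_gt0.
  rewrite mulrA ler_pdivlMr// ler_pdivrMr// [in X in X <=
      _]exprS mulrA divfK// ![_ * pi]mulrC !ler_pM2l//.
  by rewrite -natrX -[2 ^+ j.+1]natrX !ler_nat k1 k2.
have lh : 0 < `|lambda| * h by rewrite mulr_gt0.
have -> : D = K i * ((`|lambda| / 2 ^+ j) `^ b * (pi / 2) `^ b).
  rewrite /D -powR_mulrn ?(ltW lh)// -powRD; last by rewrite (gt_eqF lh) implybT.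
  rewrite -/b -powRM; [|by rewrite divr_ge0 ?exprn_ge0|by rewrite divr_ge0 ?pi_ge0].
  by congr (_ * (_ `^ _)); rewrite /h exprS; field; rewrite expf_neq0.
apply: ler_wpM2l; first by rewrite exprn_ge0// ltW// volume_gt0.
have sq (y : R) : 0 <= y -> y `^ (2 * b) = (y `^ b) ^+ 2.
  by move=> y0; rewrite mulrC powRrM -[2]/(2%:R) powR_mulrn ?powR_ge0.
rewrite !sq ?divr_ge0 ?pi_ge0 ?exprn_ge0//.
set X := _ `^ b; set P := _ `^ b.
rewrite [leLHS](_ : _ = K i ^+ 2 * (2 * X ^+ 2 * P ^+ 2)); last by ring.
rewrite [leRHS](_ : _ = (1 + \sum_i K i) ^+ 2 * (2 * X ^+ 2 * P ^+ 2)); last by ring.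
apply: ler_wpM2r; first by apply: mulr_ge0; [apply: mulr_ge0|]; rewrite ?sqr_ge0.
have [Ki0 _] := KP i; rewrite lerXn2r ?nnegrE ?addr_ge0//.
rewrite (bigD1 i)//= addrCA lerDl addr_ge0// sumr_ge0// => i' _.
by case: (KP i').
Qed.

End DyadicBlocks.

(** * Sums over the lattice *)

Section LatticeSums.
Variables (R : realType) (m : nat).
Implicit Types (k l : 'rV[int]_m) (s t : seq 'rV[int]_m) (a : 'rV[int]_m -> R) (p : R).

Definition maxabs k : nat := \max_i absz (k 0%R i).

Definition lattice_box (n : nat) : seq 'rV[int]_m :=
  [seq \row_i ((nat_of_ord ((w : 'rV['I_(n.*2.+1)]_m) 0%R i))%:Z - n%:Z) |
    w <- enum {: 'rV['I_(n.*2.+1)]_m}].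

Lemma size_lattice_box n : size (lattice_box n) = (n.*2.+1 ^ m)%N.
Proof. by rewrite size_map -cardE card_mx card_ord mul1n. Qed.

Lemma lattice_box_uniq n : uniq (lattice_box n).
Proof.
rewrite map_inj_uniq ?enum_uniq// => u v /rowP uv; apply/rowP => i.
by apply: val_inj => /=; have := uv i; rewrite !mxE => /addIr [].
Qed.

Lemma mem_lattice_box n k : (k \in lattice_box n) = [forall i, absz (k 0%R i) <= n]%N.
Proof.
apply/mapP/forallP => [[w _ ->] i|H].
  by rewrite mxE; case: (w 0%R i) => j /= jn; lia.
exists (\row_i inord (absz (k 0%R i + n%:Z))); first by rewrite mem_enum.
apply/rowP => i; rewrite !mxE inordK; move: (H i); move: (k 0%R i) => z; lia.
Qed.

Lemma le_maxabs k i : (absz (k 0%R i) <= maxabs k)%N.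
Proof. exact: (leq_bigmax i). Qed.

Lemma maxabs_ltP k n : (0 < n)%N -> reflect (forall i, (absz (k 0%R i) < n)%N) (maxabs k < n)%N.
Proof.
move=> n0; apply: (iffP idP) => [H i|H]; first exact: leq_ltn_trans (le_maxabs k i) H.
case: n n0 H => // n _ H; rewrite ltnS; apply/bigmax_leqP => i _; exact: H.
Qed.

Lemma size_small_maxabs s n : uniq s -> (forall k, k \in s -> maxabs k < 2 ^ n)%N ->
  (size s <= (2 ^ n.+1) ^ m)%N.
Proof.
move=> us H; have n0 : (0 < 2 ^ n)%N by rewrite expn_gt0.
have : (size s <= size (lattice_box (2 ^ n).-1))%N.
  apply: uniq_leq_size => // k /H /(maxabs_ltP _ n0) kn.
  by rewrite mem_lattice_box; apply/forallP => i; have := kn i; lia.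
move=> /leq_trans; apply; rewrite size_lattice_box; case: (posnP m) => [->//|m0].
by rewrite leq_exp2r// expnS; lia.
Qed.

(* Summed over k with the optimal tau, this replaces Hoelder's inequality. *)
Lemma young_small_power p (x tau : R) : 0 < p -> p < 2 -> 0 <= x -> 0 < tau ->
  x `^ p <= tau `^ p + x ^+ 2 * tau `^ (p - 2).
Proof.
move=> p0 p2 x0 t0; have [xt|tx] := leP x tau.
  apply: (@le_trans _ _ (tau `^ p)); last by rewrite lerDl mulr_ge0 ?powR_ge0 ?sqr_ge0.
  by apply: ge0_ler_powR => //; rewrite ?nnegrE; exact: ltW.
have x0' : 0 < x by exact: lt_trans tx.
apply: (@le_trans _ _ (x ^+ 2 * tau `^ (p - 2))); last by rewrite lerDr powR_ge0.
have -> : x `^ p = x ^+ 2 * x `^ (p - 2).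
  rewrite -powR_mulrn// -powRD; first by congr (_ `^ _); ring.
  by rewrite (gt_eqF x0') implybT.
rewrite ler_wpM2l ?sqr_ge0// -(opprB 2 p) !powRN lef_pV2 ?posrE ?powR_gt0//.
by apply: ge0_ler_powR; rewrite ?nnegrE ?ltW// subr_gt0.
Qed.

Lemma power_sum_le p s a (N S : R) : 0 < p -> p < 2 -> 0 < N -> 0 < S ->
  (forall k, 0 <= a k) -> (size s)%:R <= N -> \sum_(k <- s) a k ^+ 2 <= S ->
  \sum_(k <- s) a k `^ p <= 2 * (N `^ (1 - p / 2) * S `^ (p / 2)).
Proof.
move=> p0 p2 N0 S0 a0 sN sS.
(* The root mean square: it makes N tau^p and S tau^(p - 2) equal, whence the factor 2. *)
pose tau := (S / N) `^ 2^-1.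
have SN : 0 < S / N by rewrite divr_gt0.
have t0 : 0 < tau by rewrite powR_gt0.
apply: (@le_trans _ _ (\sum_(k <- s) (tau `^ p + a k ^+ 2 * tau `^ (p - 2)))).
  by apply: ler_sum => k _; exact: young_small_power.
rewrite big_split /= -mulr_suml big_const_seq count_predT iter_addr addr0 -[tau `^ p *+ _]mulr_natl.
have SNp b : (S / N) `^ b = S `^ b * N `^ (- b).
  by rewrite powRM ?invr_ge0 ?ltW// -powR_inv1 ?ltW// -powRrM mulN1r.
have Nn b c : N `^ b * N `^ c = N `^ (b + c) by rewrite powRD// (gt_eqF N0) implybT.
have Ss b c : S `^ b * S `^ c = S `^ (b + c) by rewrite powRD// (gt_eqF S0) implybT.
have e1 : N * tau `^ p = N `^ (1 - p / 2) * S `^ (p / 2).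
  rewrite /tau -powRrM [2^-1 * p]mulrC SNp mulrCA -{1}(powRr1 (ltW N0)) Nn.
  exact: mulrC.
have e2 : S * tau `^ (p - 2) = N `^ (1 - p / 2) * S `^ (p / 2).
  rewrite /tau -powRrM SNp -{1}(powRr1 (ltW S0)) mulrA Ss mulrC.
  by congr (_ `^ _ * _ `^ _); field.
rewrite [leRHS](_ : _ = N `^ (1 - p / 2) * S `^ (p / 2) + N `^ (1 - p / 2) * S `^ (p / 2));
    last by ring.
apply: lerD.
  by rewrite -e1 ler_wpM2r ?powR_ge0.
by rewrite -e2 ler_wpM2r ?powR_ge0.
Qed.

(** Each index of the block has a coordinate attaining [maxabs], so the block is covered by [m]
    slabs on each of which one fixed coordinate is of size 2^j. *)
Lemma dyadic_block_l2 s a j (K : R) : uniq s ->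
  (forall i t, uniq t -> (forall k, k \in t -> (2 ^ j <= absz (k 0%R i) <= 2 ^ j.+1)%N) ->
     \sum_(k <- t) a k ^+ 2 <= K) ->
  (forall k, k \in s -> (2 ^ j <= maxabs k < 2 ^ j.+1)%N) ->
  \sum_(k <- s) a k ^+ 2 <= m%:R * K.
Proof.
move=> us HK Hs.
apply: (@le_trans _ _ (\sum_(k <- s) \sum_(i < m | (2 ^ j <= absz (k 0%R i) <=
    2 ^ j.+1)%N) a k ^+ 2)).
  rewrite big_seq [leRHS]big_seq; apply: ler_sum => k /Hs /andP[k1 k2].
  have [i ki] : exists i, absz (k 0%R i) = maxabs k.
    have : (0 < #|'I_m|)%N.
      rewrite card_ord lt0n; apply/negP => /eqP m0; move: k1.
      rewrite /maxabs big1; first by rewrite leqn0 expn_eq0.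
      by move=> i _; have := ltn_ord i; rewrite {2}m0.
    by move=> /(eq_bigmax_cond (fun i : 'I_m => absz (k 0%R i)))[i _ E]; exists i;
        rewrite /maxabs -E.
  rewrite (bigD1 i) /=; last by rewrite ki k1 ltnW.
  by rewrite lerDl sumr_ge0// => *; exact: sqr_ge0.
rewrite (exchange_big_dep predT)//=.
have -> : m%:R * K = \sum_(i < m) K by rewrite big_const_ord iter_addr addr0 mulr_natl.
apply: ler_sum => i _; rewrite -big_filter; apply: (HK i).
  exact: filter_uniq.
by move=> k; rewrite mem_filter => /andP[].
Qed.

Lemma dyadic_bracket (L : R) : 1 <= L -> exists J : nat, L <= 2 ^+ J <= 2 * L.
Proof.
move=> L1; have ex : exists n, L <= 2 ^+ n.
  exists (Num.truncn L).+1; have := truncnS_gt L => /ltW /le_trans; apply.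
  by rewrite -natrX ler_nat ltnW// ltn_expl.
exists (ex_minn ex); case: ex_minnP => [[|n] Ln mn].
  by rewrite Ln expr0; lra.
rewrite Ln /= exprS ler_pM2l// leNgt; apply/negP => /ltW /mn; lia.
Qed.

Lemma geometric_sum_le (q : R) n : 0 <= q -> q < 1 -> \sum_(d < n) q ^+ d <= (1 - q)^-1.
Proof.
move=> q0 q1; have d0 : 0 < 1 - q by rewrite subr_gt0.
rewrite -[leRHS]mul1r ler_pdivlMr// mulrC -opprB mulNr -subrX1 opprB lerBlDr lerDl.
exact: exprn_ge0.
Qed.

Lemma dyadic_power_sum p (beta K : R) : 0 < p -> p < 2 -> 0 < K -> 0 <= beta ->
  m%:R * (p^-1 - 2^-1) < beta -> (0 < m)%N ->
  exists2 C, 0 < C & forall (L : R) a s, 1 <= L -> (forall k, 0 <= a k) ->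
  (forall t, uniq t -> \sum_(k <- t) a k ^+ 2 <= 2) ->
  (forall j i t, uniq t -> (forall k, k \in t -> (2 ^ j <= absz (k 0%R i) <= 2 ^ j.+1)%N) ->
     \sum_(k <- t) a k ^+ 2 <= K * (L / 2 ^+ j) `^ (2 * beta)) ->
  uniq s -> \sum_(k <- s) a k `^ p <= C * L `^ (m%:R * (1 - p / 2)).
Proof.
move=> p0 p2 K0 b0 mb m0.
pose th := m%:R * (1 - p / 2).
(* A block at 2^j contributes a multiple of 2^(j th) (L / 2^j)^(beta p) = L^th (L / 2^j)^gam. The
   hypothesis on [beta], multiplied by [p], says gam > 0, so the blocks beyond 2^J >= L decay with
   ratio [q]. *)
pose gam := beta * p - th.
have gam0 : 0 < gam.
  rewrite subr_gt0 /th; have -> : m%:R * (1 - p / 2) = m%:R * (p^-1 - 2^-1) * p by field;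
      rewrite gt_eqF.
  by rewrite ltr_pM2r.
pose q : R := 2 `^ (- gam).
have q0 : 0 <= q by exact: powR_ge0.
have q1 : q < 1.
  rewrite /q powRN invf_lt1 ?powR_gt0//.
  have := @gt0_ltr_powR R gam gam0 1 2; rewrite !nnegrE powR1; apply => //.
  by rewrite ltr1n.
(* The indices with [maxabs] below 2^J number at most (2^(J+1))^m <= (4 L)^m, because 2^J <= 2 L; a
   block at 2^j has at most (4 * 2^j)^m, whence the 4 in both constants. *)
pose C0 : R := 2 * (4 `^ th * 2 `^ (p / 2)).
pose C1 : R := 2 * (4 `^ th * (m%:R * K) `^ (p / 2)).
have mK : 0 < m%:R * K by rewrite mulr_gt0// ltr0n.
have C0p : 0 < C0 by rewrite !mulr_gt0 ?powR_gt0.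
have C1p : 0 < C1 by rewrite !mulr_gt0 ?powR_gt0.
exists (C0 + C1 * (1 - q)^-1).
  by apply: addr_gt0 => //; apply: divr_gt0 => //; rewrite subr_gt0.
move=> L a s L1 a0 l2 Hd us.
have L0 : 0 < L by exact: lt_le_trans L1.
have [J /andP[J1 J2]] := dyadic_bracket L1.
have th0 : 0 <= th by rewrite /th mulr_ge0// subr_ge0 ler_pdivrMr// mul1r ltW.
have powm (x : R) : 0 <= x -> (x ^+ m) `^ (1 - p / 2) = x `^ th.
  by move=> x0; rewrite -powR_mulrn// -powRrM.
have block n t : uniq t -> (forall k, k \in t -> (2 ^ (J + n) <= maxabs k < 2 ^ (J + n).+1)%N) ->
    \sum_(k <- t) a k `^ p <= C1 * q ^+ n * L `^ th.
  move=> ut Ht; set j := (J + n)%N.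
  have X0 : 0 < 2 ^+ j :> R by rewrite exprn_gt0.
  have LX : 0 < L / 2 ^+ j by rewrite divr_gt0.
  have := @power_sum_le p t a ((4 * 2 ^+ j) ^+ m) (m%:R * (K * (L / 2 ^+ j) `^ (2 * beta))) p0 p2.
  move=> /(_ _ _ a0) H; apply: le_trans (H _ _ _ _) _.
  - by rewrite exprn_gt0// mulr_gt0.
  - by rewrite !mulr_gt0 ?powR_gt0// ltr0n.
  - have -> : 4 * 2 ^+ j = (2 ^ j.+2)%N%:R :> R by rewrite natrX !exprS; ring.
    rewrite -natrX ler_nat; apply: size_small_maxabs => // k /Ht /andP[_].
    by [].
  - apply: (@dyadic_block_l2 t a j _ ut); last exact: Ht.
    by move=> i t' ut' Ht'; exact: Hd Ht'.
  rewrite powm; last by rewrite mulr_ge0// ltW.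
  rewrite (mulrA m%:R K) [(m%:R * K * _) `^ _]powRM ?(ltW mK) ?powR_ge0//.
  rewrite [(4 * 2 ^+ j) `^ th]powRM ?(ltW X0)// -powRrM.
  rewrite (_ : 2 * beta * (p / 2) = th + gam); last by rewrite /gam; field.
  rewrite powRD; last by rewrite (gt_eqF LX) implybT.
  have E : (2 ^+ j) `^ th * (L / 2 ^+ j) `^ th = L `^ th.
    by rewrite -powRM ?(ltW X0) ?(ltW LX)// mulrC divfK// gt_eqF.
  have G : (L / 2 ^+ j) `^ gam <= q ^+ n.
    apply: (@le_trans _ _ ((2 ^- n) `^ gam)).
      apply: ge0_ler_powR; rewrite ?nnegrE ?(ltW gam0) ?(ltW LX) ?invr_ge0 ?exprn_ge0//.
      by rewrite ler_pdivrMr// /j exprD mulrCA mulVf ?mulr1// expf_neq0.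
    rewrite -powR_mulrn// /q -powR_invn// -!powRrM.
    by rewrite (_ : - n%:R * gam = - gam * n%:R) //; ring.
  have -> : 2 * (4 `^ th * (2 ^+ j) `^ th * ((m%:R * K) `^ (p / 2) * ((L / 2 ^+ j) `^ th * (L / 2
      ^+ j) `^ gam)))
     = C1 * L `^ th * (L / 2 ^+ j) `^ gam by rewrite -E /C1; ring.
  rewrite [leRHS]mulrAC ler_wpM2l// mulr_ge0 ?powR_ge0//; exact: ltW.
have main n t : uniq t -> (forall k, k \in t -> (maxabs k < 2 ^ (J + n))%N) ->
    \sum_(k <- t) a k `^ p <= (C0 + C1 * \sum_(d < n) q ^+ d) * L `^ th.
  elim: n t => [|n IH] t ut Ht.
    rewrite big_ord0 mulr0 addr0.
    have := @power_sum_le p t a ((4 * L) ^+ m) 2 p0 p2.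
    move=> /(_ _ _ a0) H; apply: le_trans (H _ _ _ _) _ => //.
    - by rewrite exprn_gt0// mulr_gt0.
    - apply: (@le_trans _ _ ((2 * 2 ^+ J) ^+ m)); last first.
        by rewrite lerXn2r ?nnegrE ?mulr_ge0 ?exprn_ge0 ?(ltW L0)//; lra.
      rewrite -exprS -natrX -natrX ler_nat; apply: size_small_maxabs => // k /Ht.
      by rewrite addn0.
    - exact: l2.
    by rewrite powm ?mulr_ge0 ?(ltW L0)// powRM ?(ltW L0)// /C0 le_eqVlt; apply/orP; left;
        apply/eqP; ring.
  rewrite (bigID (fun k => (maxabs k < 2 ^ (J + n))%N)) /= -big_filter -[X in _ + X]big_filter.
  rewrite big_ord_recr /= mulrDr addrA mulrDl; apply: lerD.
    by apply: IH; [exact: filter_uniq|move=> k; rewrite mem_filter => /andP[]].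
  apply: block; first exact: filter_uniq.
  by move=> k; rewrite mem_filter -leqNgt => /andP[-> /Ht]; rewrite addnS.
pose n := \max_(k <- s) maxabs k.
apply: le_trans (main n s us _) _.
  move=> k ks; apply: (@leq_ltn_trans n); first exact: leq_bigmax_seq.
  by apply: leq_trans (ltn_expl n (ltnSn 1)) _; rewrite leq_pexp2l// leq_addl.
rewrite ler_wpM2r ?powR_ge0// lerD2l ler_wpM2l ?(ltW C1p)//; exact: geometric_sum_le.
Qed.

End LatticeSums.

(** * Concentration of the spectrum *)

Section Concentration.
Variables (R : realType) (m : nat).
Implicit Types (x y : 'rV[R]_m) (k l : 'rV[int]_m) (s t : seq 'rV[int]_m) (q r F : 'rV[int]_m -> R).

Local Notation V := ((2 * pi) ^+ m : R).

Lemma sum_same_support s t F : uniq s -> uniq t -> (forall l, F l != 0 -> (l \in s) && (l \in t)) ->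
  \sum_(l <- s) F l = \sum_(l <- t) F l.
Proof.
move=> us ut H.
have nz w : \sum_(l <- w) F l = \sum_(l <- [seq l <- w | F l != 0]) F l.
  rewrite big_filter [RHS]big_mkcond; apply: eq_bigr => l _.
  by case: eqP.
rewrite nz [RHS]nz; apply: perm_big; apply: uniq_perm; rewrite ?filter_uniq// => l.
by rewrite !mem_filter; case: eqP => //= /eqP /H /andP[-> ->].
Qed.

Lemma sum_subset s t F : uniq s -> uniq t -> {subset s <= t} -> (forall l, 0 <= F l) ->
  \sum_(l <- s) F l <= \sum_(l <- t) F l.
Proof.
move=> us ut st F0; rewrite [leRHS](bigID (mem s)) /= -[X in X + _]big_filter.
rewrite (perm_big [seq l <- t | l \in s]) ?lerDl ?sumr_ge0//.
apply: uniq_perm; rewrite ?filter_uniq// => l.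
by rewrite mem_filter; case: (boolP (l \in s)) => // /st ->.
Qed.

Definition int_unitv (i : 'I_m) : 'rV[int]_m := delta_mx 0 i.

Lemma kdot_int_unitv i y : kdot (int_unitv i) y = y 0 i.
Proof.
rewrite /kdot (bigD1 i) //= big1 => [|j ji].
  by rewrite mxE !eqxx mul1r addr0.
by rewrite mxE (negbTE ji) andbF mul0r.
Qed.

Definition sum_cos s q y : R := \sum_(l <- s) q l * cos (kdot l y).
Definition sum_sin s q y : R := \sum_(l <- s) q l * sin (kdot l y).

Lemma sum_cos_trig s q x0 x : sum_cos s q (x - x0) =
  trig_re s (fun l => q l * cos (kdot l x0)) (fun l => - (q l * sin (kdot l x0))) x.
Proof. by apply: eq_bigr => l _; rewrite kdotB cosB; ring. Qed.

Lemma sum_sin_trig s q x0 x : sum_sin s q (x - x0) =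
  trig_im s (fun l => q l * cos (kdot l x0)) (fun l => - (q l * sin (kdot l x0))) x.
Proof. by apply: eq_bigr => l _; rewrite kdotB sinB; ring. Qed.

Lemma blip_sum_cos s q x0 : blip (fun x => sum_cos s q (x - x0)).
Proof. by under eq_fun do rewrite sum_cos_trig; exact: blip_trig_re. Qed.

Lemma blip_sum_sin s q x0 : blip (fun x => sum_sin s q (x - x0)).
Proof. by under eq_fun do rewrite sum_sin_trig; exact: blip_trig_im. Qed.

Lemma parseval_centered s q x0 : uniq s ->
  cube_integral (fun x => sum_cos s q (x - x0) ^+ 2 + sum_sin s q (x - x0) ^+ 2) =
  V * \sum_(l <- s) q l ^+ 2.
Proof.
move=> us; under cube_integral_ext do rewrite sum_cos_trig sum_sin_trig.
rewrite parseval//; congr (_ * _); apply: eq_bigr => l _.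
by rewrite sqrrN !exprMn -mulrDr cos2Dsin2 mulr1.
Qed.

(** This is |Q(y)|^2 for the polynomial Q(y) = sum_l q_l e^{i(l,y)}. *)
Definition kernel s q y : R := sum_cos s q y ^+ 2 + sum_sin s q y ^+ 2.

Lemma kernel_ge0 s q y : 0 <= kernel s q y.
Proof. by rewrite addr_ge0 ?sqr_ge0. Qed.

Lemma blip_kernel s q x0 : blip (fun x => kernel s q (x - x0)).
Proof.
by apply: blipD; apply: blip_sqr; [exact: blip_sum_cos|exact: blip_sum_sin].
Qed.

(** Reindexing by the translation l -> l + e_i. The support condition keeps both the support and its
    translate inside [s], so there are no boundary terms. *)
Lemma shifted_trig s q (i : 'I_m) (f : R -> R) y : uniq s ->
  (forall l, q l != 0 -> (l \in s) && (l + int_unitv i \in s)) ->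
  \sum_(l <- s) q (l - int_unitv i) * f (kdot l y) = \sum_(l <- s) q l * f (kdot l y + y 0 i).
Proof.
move=> us H.
rewrite -[RHS](@sum_same_support [seq l - int_unitv i | l <- s]) //; last 2 first.
- by rewrite map_inj_uniq// => u v /addIr.
- move=> l; rewrite mulf_eq0 negb_or => /andP[/H /andP[-> ls] _].
  by rewrite andbT; apply/mapP; exists (l + int_unitv i) => //; rewrite addrK.
rewrite big_map; apply: eq_bigr => l _.
by rewrite kdotBl kdot_int_unitv subrK.
Qed.

(* Multiplying a trigonometric polynomial by e^{i y_i} - 1 takes differences of its coefficients. *)
Lemma kernel_1Bcos s q (i : 'I_m) y : uniq s ->
  (forall l, q l != 0 -> (l \in s) && (l + int_unitv i \in s)) ->
  kernel s q y * (2 * (1 - cos (y 0 i))) = kernel s (fun l => q (l - int_unitv i) - q l) y.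
Proof.
move=> us H.
have ec : sum_cos s (fun l => q (l - int_unitv i) - q l) y =
    cos (y 0 i) * sum_cos s q y - sin (y 0 i) * sum_sin s q y - sum_cos s q y.
  rewrite {1}/sum_cos; under eq_bigr do rewrite mulrBl.
  rewrite sumrB shifted_trig//; congr (_ - _); rewrite !mulr_sumr -sumrB.
  by apply: eq_bigr => l _; rewrite cosD; ring.
have es : sum_sin s (fun l => q (l - int_unitv i) - q l) y =
    cos (y 0 i) * sum_sin s q y + sin (y 0 i) * sum_cos s q y - sum_sin s q y.
  rewrite {1}/sum_sin; under eq_bigr do rewrite mulrBl.
  rewrite sumrB shifted_trig//; congr (_ - _); rewrite !mulr_sumr -big_split.
  by apply: eq_bigr => l _; rewrite /= sinD; ring.
rewrite /kernel ec es; move: (cos2Dsin2 (y 0 i)).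
move: (sum_cos s q y) (sum_sin s q y) (cos _) (sin _) => P Q c d cd.
rewrite [RHS](_ : _ = (P ^+ 2 + Q ^+ 2) * (c ^+ 2 + d ^+ 2 + 1 - 2 * c)); last by ring.
by rewrite cd; ring.
Qed.

(** The real part of Q(y) times its conjugate times e^{i th}, expanded. *)
Lemma kernel_cosE s q y (th : R) : kernel s q y * cos th =
  \sum_(l <- s) \sum_(l' <- s) q l * q l' * cos (th + (kdot l y - kdot l' y)).
Proof.
have -> : kernel s q y * cos th = cos th * (sum_cos s q y * sum_cos s q y + sum_sin s q y *
    sum_sin s q y)
   - sin th * (sum_sin s q y * sum_cos s q y - sum_cos s q y * sum_sin s q y).
  by rewrite /kernel; ring.
rewrite /sum_cos /sum_sin !big_distrlr -sumrB -big_split !mulr_sumr -sumrB.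
apply: eq_bigr => l _; rewrite -sumrB -big_split !mulr_sumr -sumrB.
by apply: eq_bigr => l' _; rewrite /= cosD cosB sinB; ring.
Qed.

Variables (phi : 'rV[R]_m -> R) (lambda : R).
Hypothesis phi_lip : exists M, lipschitz1 M phi.

Let a k := fourier_abs lambda phi k.

(** After division by V the left side is the real part of e^{i w} times a Fourier coefficient, hence
    at most its modulus. *)
Lemma integral_phase_le k (w : R) :
  cube_integral (fun x => cos (lambda * phi x - kdot k x + w)) <= V * a k.
Proof.
have [M HM] := phi_lip.
have lp := lipschitz1_phase lambda k 0 HM.
have bc : blip (fun x => cos (lambda * phi x - kdot k x)).
  by under eq_fun do rewrite -[X in cos X]addr0; exact: blip_cos lp.
have bs : blip (fun x => sin (lambda * phi x - kdot k x)).
  by under eq_fun do rewrite -[X in sin X]addr0; exact: blip_sin lp.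
under cube_integral_ext do rewrite cosD mulrC [X in _ - X]mulrC.
rewrite cube_integralB; [|exact: blipZ|exact: blipZ].
rewrite !cube_integralZ// /a /fourier_abs.
rewrite -ler_pdivrMl ?volume_gt0//.
rewrite [leLHS](_ : _ = cos w * fourier_re lambda phi k - sin w * fourier_im lambda phi k);
    last first.
  by rewrite /fourier_re /fourier_im; ring.
move: (fourier_re _ _ _) (fourier_im _ _ _) => u v.
apply: le_trans (ler_norm _) _; rewrite -sqrtr_sqr ler_sqrt ?addr_ge0 ?sqr_ge0//.
have cs := cos2Dsin2 w; rewrite -subr_ge0.
rewrite [leRHS](_ : _ = (u ^+ 2 + v ^+ 2) * (1 - (cos w ^+ 2 + sin w ^+ 2)) + (sin w * u + cos w
    * v) ^+ 2); last by ring.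
by rewrite cs subrr mulr0 add0r sqr_ge0.
Qed.

Variables (x0 : 'rV[R]_m) (xi : 'rV[int]_m) (s : seq 'rV[int]_m) (q : 'rV[int]_m -> R) (E : R).
Hypotheses (us : uniq s) (q_ge0 : forall l, 0 <= q l)
  (q_supp : forall i l, q l != 0 -> (l \in s) && (l + int_unitv i \in s))
  (energy : E * (\sum_i \sum_(l <- s) (q (l - int_unitv i) - q l) ^+ 2) <=
    3 / 4 * \sum_(l <- s) q l ^+ 2).

(** The phase relative to the plane wave of frequency [xi], normalised to vanish at [x0]. *)
Let theta x : R := lambda * phi x - lambda * phi x0 - kdot xi (x - x0).

Hypothesis theta_small : forall x,
  1 - cos (theta x) <= 8^-1 + E * \sum_i (1 - cos ((x - x0) 0 i)).

Let thetaE x : theta x = lambda * phi x - kdot xi x + (kdot xi x0 - lambda * phi x0).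
Proof. by rewrite /theta kdotB; ring. Qed.

Let blip_cos_theta : blip (fun x => cos (theta x)).
Proof.
have [M HM] := phi_lip; under eq_fun do rewrite thetaE.
exact: blip_cos (lipschitz1_phase _ _ _ HM).
Qed.

Let kernel_cos_upper : cube_integral (fun x => kernel s q (x - x0) * cos (theta x)) <=
  V * \sum_(l <- s) \sum_(l' <- s) q l * q l' * a (xi - l + l').
Proof.
have [M HM] := phi_lip.
have e x : kernel s q (x - x0) * cos (theta x) = \sum_(l <- s) \sum_(l' <- s) q l * q l' *
  cos (lambda * phi x - kdot (xi - l + l') x + (kdot (xi - l + l') x0 - lambda * phi x0)).
  rewrite kernel_cosE; apply: eq_bigr => l _; apply: eq_bigr => l' _; congr (_ * cos _).
  by rewrite thetaE !kdotDl !kdotNl !kdotB; ring.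
under cube_integral_ext do rewrite e.
have bl l l' : blip (fun x => q l * q l' *
  cos (lambda * phi x - kdot (xi - l + l') x + (kdot (xi - l + l') x0 - lambda * phi x0))).
  by apply: blipZ; exact: blip_cos (lipschitz1_phase _ _ _ HM).
rewrite cube_integral_sum; last by move=> l; exact: blip_sum.
rewrite mulr_sumr; apply: ler_sum => l _.
rewrite cube_integral_sum// mulr_sumr; apply: ler_sum => l' _.
rewrite cube_integralZ; last exact: blip_cos (lipschitz1_phase _ _ _ HM).
by rewrite mulrCA ler_wpM2l ?mulr_ge0//; exact: integral_phase_le.
Qed.

Let integral_kernel : cube_integral (fun x => kernel s q (x - x0)) = V * \sum_(l <- s) q l ^+ 2.
Proof. exact: parseval_centered. Qed.

Let blip_coord i : blip (fun x => 1 - cos ((x - x0) 0 i)).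
Proof.
apply: blipB; first exact: blip_cst.
under eq_fun do rewrite -kdot_int_unitv kdotB.
exact: blip_cos (lipschitz1_kdot _ _).
Qed.

Let integral_kernel_coord i :
  cube_integral (fun x => kernel s q (x - x0) * (1 - cos ((x - x0) 0 i))) =
  V * (2^-1 * \sum_(l <- s) (q (l - int_unitv i) - q l) ^+ 2).
Proof.
rewrite mulrCA -(parseval_centered _ x0 us) -cube_integralZ; last exact: blip_kernel.
apply: cube_integral_ext => x.
by rewrite -[X in _ = _ * X](kernel_1Bcos _ us (q_supp i)); field.
Qed.

(** By [theta_small], cos theta >= 7/8 - E sum_i (1 - cos (x_i - x0_i)). Against the kernel the
    second term costs half of the quantity bounded in [energy], that is at most 3/8 of the mass, and
    7/8 - 3/8 = 1/2. *)
Lemma kernel_concentration :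
  2^-1 * \sum_(l <- s) q l ^+ 2 <= \sum_(l <- s) \sum_(l' <- s) q l * q l' * a (xi - l + l').
Proof.
rewrite -(ler_pM2l (volume_gt0 R m)); apply: le_trans _ kernel_cos_upper.
have bk := blip_kernel s q x0.
have bS : blip (fun x => \sum_i kernel s q (x - x0) * (1 - cos ((x - x0) 0 i))).
  by apply: blip_sum => i; exact: blipM.
have : cube_integral (fun x => 7 / 8 * kernel s q (x - x0) -
   E * \sum_i kernel s q (x - x0) * (1 - cos ((x - x0) 0 i))) <=
   cube_integral (fun x => kernel s q (x - x0) * cos (theta x)).
  apply: le_cube_integral.
  - by apply: blipB; exact: blipZ.
  - exact: blipM.
  - move=> x; rewrite -mulr_sumr mulrCA.
    have := ler_wpM2l (kernel_ge0 s q (x - x0)) (theta_small x).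
    by move: (kernel _ _ _) (E * _) (cos _) => K W c; lra.
apply: le_trans; rewrite cube_integralB; [|exact: blipZ|exact: blipZ].
rewrite !cube_integralZ// cube_integral_sum => [|i]; last exact: blipM.
under [X in _ - _ * X]eq_bigr do rewrite integral_kernel_coord.
rewrite -!mulr_sumr integral_kernel.
have := energy; set A := \sum_(l <- s) _; set W := \sum_i _ => en.
rewrite [leRHS](_ : _ = V * (7 / 8 * A - 2^-1 * (E * W))); last by ring.
by rewrite ler_pM2l ?volume_gt0//; lra.
Qed.

(** Schur test: q_l q_l' <= (q_l^2 + q_l'^2) / 2, and every row and column sum of the matrix a (xi -
    l + l') is at most the sum over [D], its entries being indexed by distinct differences. *)
Lemma concentration D : uniq D -> (forall l l', l \in s -> l' \in s -> l' - l \in D) ->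
  0 < \sum_(l <- s) q l ^+ 2 ->
  2^-1 <= \sum_(d <- D) a (xi + d).
Proof.
move=> uD HD A0; set T := \sum_(d <- D) _.
have a0 k : 0 <= a k by exact: sqrtr_ge0.
have row l : l \in s -> \sum_(l' <- s) a (xi - l + l') <= T.
  move=> ls; have -> : \sum_(l' <- s) a (xi - l + l') =
      \sum_(d <- [seq l' - l | l' <- s]) a (xi + d).
    by rewrite big_map; apply: eq_bigr => l' _; rewrite addrAC addrA.
  apply: sum_subset => //; first by rewrite map_inj_uniq// => u v /addIr.
  by move=> d /mapP[l' l's ->]; exact: HD.
have col l' : l' \in s -> \sum_(l <- s) a (xi - l + l') <= T.
  move=> ls; have -> : \sum_(l <- s) a (xi - l + l') = \sum_(d <- [seq l' - l | l <- s]) a (xi + d).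
    by rewrite big_map; apply: eq_bigr => l _; rewrite addrAC addrA.
  apply: sum_subset => //; first by rewrite map_inj_uniq// => u v /addrI /oppr_inj.
  by move=> d /mapP[l l's ->]; exact: HD.
rewrite -(ler_pM2r A0); apply: le_trans kernel_concentration _.
apply: (@le_trans _ _ (\sum_(l <- s) \sum_(l' <- s)
   (2^-1 * (q l ^+ 2 * a (xi - l + l')) + 2^-1 * (q l' ^+ 2 * a (xi - l + l'))))).
  apply: ler_sum => l _; apply: ler_sum => l' _.
  rewrite -mulrDr -mulrDl mulrA ler_wpM2r//.
  have := sqr_ge0 (q l - q l'); rewrite sqrrB; lra.
under eq_bigr do rewrite big_split /=.
rewrite big_split /= [X in _ + X]exchange_big /=.
have -> : T * \sum_(l <- s) q l ^+ 2 = \sum_(l <- s) 2^-1 * (q l ^+ 2 * T) + \sum_(l <- s) 2^-1 *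
    (q l ^+ 2 * T).
  by rewrite -!mulr_sumr -!mulr_suml; field.
apply: lerD; rewrite big_seq [leRHS]big_seq; apply: ler_sum => l ls.
  by rewrite -!mulr_sumr !ler_wpM2l ?sqr_ge0// row.
by rewrite -!mulr_sumr !ler_wpM2l ?sqr_ge0// col.
Qed.

End Concentration.

(** * Lattice cubes *)

Section Packing.
Variables (R : realType) (m : nat).
Implicit Types (x : 'rV[R]_m) (k l c : 'rV[int]_m) (N : nat).

Lemma maxabs_le k n : (forall i, absz (k 0%R i) <= n)%N -> (maxabs k <= n)%N.
Proof. by move=> H; apply/bigmax_leqP => i _. Qed.

Lemma maxabs_add k l : (maxabs (k + l) <= maxabs k + maxabs l)%N.
Proof.
apply: maxabs_le => i; rewrite mxE; have := le_maxabs k i; have := le_maxabs l i.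
by move: (k 0%R i) (l 0%R i) => u v; lia.
Qed.

Lemma maxabsN k : maxabs (- k) = maxabs k.
Proof. by apply: eq_bigr => i _; rewrite mxE abszN. Qed.

Lemma maxabs_int_unitv (i : 'I_m) : (maxabs (int_unitv i) <= 1)%N.
Proof. by apply: maxabs_le => j; rewrite mxE; case: (_ && _). Qed.

Lemma mem_lattice_box_maxabs n k : (k \in lattice_box m n) = (maxabs k <= n)%N.
Proof.
rewrite mem_lattice_box; apply/forallP/idP => [|H i]; first exact: maxabs_le.
exact: leq_trans (le_maxabs k i) H.
Qed.

(** A tent, cut off at 0 by the truncated subtraction. Its differences are at most 1 while its
    values are of order n on a fixed fraction of the box, so the ratio of energy to mass is
    O(n^-2). *)
Definition cone (n : nat) k : R := (n - maxabs k)%N%:R.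

Lemma cone_ge0 n k : 0 <= cone n k.
Proof. exact: ler0n. Qed.

Lemma cone_supp n i k : cone n k != 0 ->
  (k \in lattice_box m n.+1) && (k + int_unitv i \in lattice_box m n.+1).
Proof.
rewrite pnatr_eq0 subn_eq0 -ltnNge => kn; rewrite !mem_lattice_box_maxabs.
have := maxabs_add k (int_unitv i); have := maxabs_int_unitv i; lia.
Qed.

Lemma cone_difference n i k : (cone n (k - int_unitv i) - cone n k) ^+ 2 <= 1.
Proof.
have h1 : (maxabs (k - int_unitv i) <= maxabs k + 1)%N.
  by apply: leq_trans (maxabs_add _ _) _; rewrite maxabsN leq_add2l maxabs_int_unitv.
have h2 : (maxabs k <= maxabs (k - int_unitv i) + 1)%N.
  rewrite -{1}(subrK (int_unitv i) k); apply: leq_trans (maxabs_add _ _) _.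
  by rewrite leq_add2l maxabs_int_unitv.
rewrite /cone; move: (maxabs _) (maxabs k) h1 h2 => u v h1 h2.
have [e|[e|e]] : (n - u = n - v \/ n - u = (n - v).+1 \/ n - v = (n - u).+1)%N by lia.
- by rewrite e subrr expr0n.
- by rewrite e -natr1 addrAC subrr add0r expr1n.
- by rewrite e -natr1 opprD addrA subrr add0r sqrrN expr1n.
Qed.

Lemma cone_energy n i :
  \sum_(k <- lattice_box m n.+1) (cone n (k - int_unitv i) - cone n k) ^+ 2 <=
  ((n.+1).*2.+1 ^ m)%N%:R.
Proof.
rewrite -(size_lattice_box m) -sum1_size natr_sum; apply: ler_sum => k _.
exact: cone_difference.
Qed.

Lemma cone_mass n : n%:R ^+ 2 * (n.*2.+1 ^ m)%N%:R <=
  \sum_(k <- lattice_box m (n.*2).+1) cone n.*2 k ^+ 2.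
Proof.
apply: (@le_trans _ _ (\sum_(k <- lattice_box m n) cone n.*2 k ^+ 2)).
  rewrite -(size_lattice_box m) -sum1_size natr_sum mulr_sumr big_seq [leRHS]big_seq.
  apply: ler_sum => k; rewrite mem_lattice_box_maxabs mulr1 => kn.
  by rewrite lerXn2r ?nnegrE// ler_nat; lia.
apply: sum_subset; rewrite ?lattice_box_uniq//.
- by move=> k; rewrite !mem_lattice_box_maxabs; lia.
- by move=> k; exact: sqr_ge0.
Qed.

Definition residues N : seq 'rV[int]_m :=
  [seq \row_i (nat_of_ord ((w : 'rV['I_N]_m) 0%R i))%:Z | w <- enum {: 'rV['I_N]_m}].

Lemma size_residues N : size (residues N) = (N ^ m)%N.
Proof. by rewrite size_map -cardE card_mx card_ord mul1n. Qed.

Lemma residues_uniq N : uniq (residues N).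
Proof.
rewrite map_inj_uniq ?enum_uniq// => u v /rowP uv; apply/rowP => i.
by apply: val_inj => /=; have := uv i; rewrite !mxE => -[].
Qed.

Lemma mem_residues N k : (k \in residues N) -> forall i, 0 <= k 0%R i < N%:Z.
Proof. by move=> /mapP[w _ ->] i; rewrite mxE ltz_nat ltn_ord. Qed.

Lemma residues_mem N k : (forall i, 0 <= k 0%R i < N%:Z) -> k \in residues N.
Proof.
case: N => [|N] H.
  (* For N = 0 no index can exist, and the only row is the empty one. *)
  apply/mapP; have H0 (i : 'I_m) : False by have := H i; lia.
  by exists (\row_i (match H0 i with end)); [rewrite mem_enum|apply/rowP => i; case: (H0 i)].
apply/mapP; exists (\row_i inord (absz (k 0%R i))); first by rewrite mem_enum.
by apply/rowP => i; rewrite !mxE inordK; have := H i; move: (k 0%R i) => z; lia.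
Qed.

Lemma residue_decomposition N c c' k k' : (k \in residues N) -> (k' \in residues N) ->
  c *+ N + k = c' *+ N + k' -> c = c' /\ k = k'.
Proof.
move=> /mem_residues kN /mem_residues kN' E.
have H i : c 0%R i = c' 0%R i /\ k 0%R i = k' 0%R i.
  have := congr1 (fun v : 'rV[int]_m => v 0%R i) E; rewrite !mxE !mulmxnE.
  have := kN i; have := kN' i; rewrite -[c 0%R i *+ N]mulr_natr -[c' 0%R i *+ N]mulr_natr natz.
  move: (c 0%R i) (c' 0%R i) (k 0%R i) (k' 0%R i) => u u' v v' /andP[a1 a2] /andP[b1 b2] e.
  have N0 : N%:Z != 0 by lia.
  have u_eq : u = u'.
    have := congr1 (fun z => z %/ N%:Z)%Z e.
    by rewrite !divzMDl// !divz_small ?addr0// ?a1 ?a2 ?b1 ?b2//; lia.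
  by split=> //; move: e; rewrite u_eq; lia.
by split; apply/rowP => i; case: (H i).
Qed.

(** * Cubes of frequencies, their counting and their overlaps *)

Definition frequencies N B : seq 'rV[int]_m :=
  [seq d *+ N + k | d <- lattice_box m B, k <- residues N].

Lemma size_frequencies N B : size (frequencies N B) = (B.*2.+1 ^ m * N ^ m)%N.
Proof. by rewrite size_allpairs size_lattice_box size_residues. Qed.

Lemma frequencies_uniq N B : uniq (frequencies N B).
Proof.
apply: allpairs_uniq; rewrite ?lattice_box_uniq ?residues_uniq//.
move=> [d k] [d' k'] /allpairsP[[u v] /= [_ vr [-> ->]]] /allpairsP[[u' v'] /= [_ vr' [-> ->]]] /=.
by move=> /(residue_decomposition vr vr')[-> ->].
Qed.

Lemma mem_frequencies N B k : (0 < N)%N -> (maxabs k <= B * N)%N -> k \in frequencies N B.+1.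
Proof.
move=> N0 kB; apply/allpairsP.
exists (\row_i (k 0%R i %/ N%:Z)%Z, \row_i (k 0%R i %% N%:Z)%Z); split=> /=.
- rewrite mem_lattice_box; apply/forallP => i; rewrite mxE.
  have := leq_trans (le_maxabs k i) kB.
  have := divz_eq (k 0%R i) N%:Z; have := modz_ge0 (k 0%R i) (d := N%:Z);
      have := ltz_pmod (k 0%R i) (d := N%:Z).
  move: (k 0%R i) (k 0%R i %/ N%:Z)%Z (k 0%R i %% N%:Z)%Z => z u r r1 r2 zE zB.
  have N0' : 0 < N%:Z by lia.
  have u1 : u <= B%:Z by rewrite -(ler_pM2r N0'); lia.
  have u2 : - B%:Z < u + 1 by rewrite -(ltr_pM2r N0'); lia.
  lia.
- apply: residues_mem => i; rewrite mxE modz_ge0 ?ltz_pmod//; lia.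
- apply/rowP => i; rewrite !mxE mulmxnE mxE -[_ *+ N]mulr_natr natz; exact: divz_eq.
Qed.

(** A reverse Hoelder bound by a threshold: x <= tau + tau^(1 - p) x^p. With tau = 1 / (4 |D|) the
    first terms add up to 1/4, which leaves 1/4 for the powers. *)
Lemma power_sum_ge (D : seq 'rV[int]_m) (a : 'rV[int]_m -> R) (p : R) : 1 <= p ->
  (forall k, 0 <= a k) -> 2^-1 <= \sum_(d <- D) a d ->
  4^-1 * (4 * (size D)%:R) `^ (1 - p) <= \sum_(d <- D) a d `^ p.
Proof.
move=> p1 a0 HD.
have sD : 0 < (size D)%:R :> R.
  rewrite ltr0n lt0n; apply/eqP => /size0nil D0.
  by move: HD; rewrite D0 big_nil; lra.
pose tau : R := (4 * (size D)%:R)^-1.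
have t0 : 0 < tau by rewrite invr_gt0 mulr_gt0.
have yg (x : R) : 0 <= x -> x <= tau + tau `^ (1 - p) * x `^ p.
  move=> x0; have [xt|tx] := leP x tau.
    by apply: le_trans xt _; rewrite lerDl mulr_ge0 ?powR_ge0.
  have x0' : 0 < x by exact: lt_trans tx.
  apply: (@le_trans _ _ (tau `^ (1 - p) * x `^ p)); last by rewrite lerDr ltW.
  have {1}-> : x = x `^ (1 - p) * x `^ p.
    by rewrite -powRD ?(gt_eqF x0') ?implybT// subrK powRr1.
  rewrite ler_wpM2r ?powR_ge0// -(opprB p 1) !powRN lef_pV2 ?posrE ?powR_gt0//.
  by apply: ge0_ler_powR; rewrite ?nnegrE ?subr_ge0// ltW.
have : 2^-1 <= (size D)%:R * tau + tau `^ (1 - p) * \sum_(d <- D) a d `^ p.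
  apply: (le_trans HD); apply: (@le_trans _ _ (\sum_(d <- D) (tau + tau `^ (1 - p) * a d `^ p))).
    by apply: ler_sum => d _; exact: yg.
  by rewrite big_split /= -mulr_sumr big_const_seq count_predT iter_addr addr0 mulr_natl.
have -> : (size D)%:R * tau = 4^-1.
  by rewrite /tau; field; rewrite gt_eqF.
have -> : tau `^ (1 - p) = ((4 * (size D)%:R) `^ (1 - p))^-1.
  by rewrite /tau -powR_inv1 ?mulr_ge0// -powRrM mulN1r powRN.
have q0 : 0 < (4 * (size D)%:R) `^ (1 - p) by rewrite powR_gt0// mulr_gt0.
move=> H; rewrite -ler_pdivlMr// mulrC; move: (_^-1 * _) H => z; lra.
Qed.

(** For each fixed [d] in the box, the points (c + d) N + r with c in [Cs] and r a residue are
    pairwise distinct, so their sum is at most [T]; the overlap is the number of choices of [d]. *)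
Lemma packing_sum (b : 'rV[int]_m -> R) (T : R) N B (Cs : seq 'rV[int]_m) :
  uniq Cs -> (forall t, uniq t -> \sum_(k <- t) b k <= T) ->
  \sum_(c <- Cs) \sum_(d <- frequencies N B) b (c *+ N + d) <= (B.*2.+1 ^ m)%N%:R * T.
Proof.
move=> uC HT.
have -> : \sum_(c <- Cs) \sum_(d <- frequencies N B) b (c *+ N + d) =
  \sum_(d <- lattice_box m B) \sum_(k <- [seq c *+ N + r | c <- [seq c + d | c <- Cs], r <-
    residues N]) b k.
  under eq_bigr do rewrite big_allpairs_dep /=.
  rewrite exchange_big /=; apply: eq_bigr => d _.
  rewrite big_allpairs_dep /= big_map; apply: eq_bigr => c _; apply: eq_bigr => r _.
  by rewrite mulrnDl addrA.
rewrite -(size_lattice_box m) -sum1_size natr_sum mulr_suml; apply: ler_sum => d _.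
rewrite mul1r; apply: HT; apply: allpairs_uniq; rewrite ?residues_uniq//.
  by rewrite map_inj_uniq// => u v /addIr.
move=> [u k] [u' k'] /allpairsP[[w v] /= [_ vr [-> ->]]] /allpairsP[[w' v'] /= [_ vr' [-> ->]]] /=.
by move=> /(residue_decomposition vr vr')[-> ->].
Qed.

(** [e] witnesses that [A] is not null, independently of the grid. The boxes of half-side [h] around
    the points r c with P c cover [A], so some finite partial sum of their volumes exceeds [e]; its
    cells form [Cs]. *)
Lemma positive_measure_cells (A : set 'rV[R]_m) : (0 < m)%N -> positive_measure A ->
  exists2 e : R, 0 < e & forall (r h : R) (P : 'rV[int]_m -> Prop), 0 <= h ->
  (forall x, A x -> exists2 c, P c & forall i, `|x 0 i - r * (c 0%R i)%:~R| <= h) ->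
  exists Cs, [/\ uniq Cs, forall c, c \in Cs -> P c & e < (size Cs)%:R * (2 * h) ^+ m].
Proof.
move=> m0 /existsNP[e /not_implyP[e0 He]]; exists e => // r h P h0 HP.
(* The boxes are indexed by codes of lattice points; codes of points outside P get a degenerate
   box, of volume 0 because m > 0. *)
pose good n : option 'rV[int]_m := obind (fun c => if `[< P c >] then Some c else None)
  (pickle_inv n).
pose lo n : 'rV[R]_m := if good n is Some c then \row_i (r * (c 0%R i)%:~R - h) else 0.
pose hi n : 'rV[R]_m := if good n is Some c then \row_i (r * (c 0%R i)%:~R + h) else 0.
have volE n : vol (lo n) (hi n) = if good n is Some _ then (2 * h) ^+ m else 0.
  rewrite /vol /lo /hi; case: (good n) => [c|].
    under eq_bigr => i _ do rewrite !mxE.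
    rewrite (eq_bigr (fun=> 2 * h)) => [|i _]; last by ring.
    by rewrite prodr_const card_ord.
  by rewrite (bigD1 (Ordinal m0)) //= !mxE subrr mul0r.
have : ~ forall N, \sum_(n < N) vol (lo n) (hi n) <= e.
  move=> H; apply: He; exists lo, hi; split; [|split=> //].
  - move=> n i; rewrite /lo /hi; case: (good n) => [c|//]; rewrite !mxE; lra.
  - move=> x /HP[c Pc Hc]; exists (pickle c) => // i.
    have gE : good (pickle c) = Some c by rewrite /good pickleK_inv /= asboolT.
    by rewrite /lo /hi gE !mxE; have := Hc i; rewrite ler_norml; lra.
move=> /existsNP[N /negP]; rewrite -ltNge => HN.
exists (pmap good (iota 0 N)); split.
- apply: (@pmap_uniq _ _ good (@pickle _)); last exact: iota_uniq.
  move=> n; rewrite /good; case E: (pickle_inv n) => [c|] //=; case: asboolP => //= _.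
  have := @pickle_invK 'rV[int]_m n; rewrite /ocancel E /=. exact.
- move=> c; rewrite mem_pmap => /mapP[n _]; rewrite /good.
  by case: (pickle_inv n) => //= c'; case: asboolP => //= Pc' [->].
- apply: (lt_le_trans HN).
  have -> : \sum_(n < N) vol (lo n) (hi n) = \sum_(n <- iota 0 N) if good n is Some _ then (2 *
      h) ^+ m else 0.
    rewrite -(big_mkord xpredT (fun n => vol (lo n) (hi n))) /index_iota subn0.
    by apply: eq_bigr => n _; exact: volE.
  elim: (iota 0 N) => [|n s IH]; first by rewrite big_nil mul0r.
  rewrite big_cons /=; case: (good n) => [c|] /=; last by rewrite add0r.
  by rewrite -[(size _).+1%:R]natr1 [leRHS]mulrDl mul1r [leLHS]addrC lerD2r.
Qed.

End Packing.

(** * The lower bound *)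

Section LowerBound.
Variables (R : realType) (m nu : nat) (alpha : R) (phi : 'rV[R]_m -> R).
Hypotheses (m_gt0 : (0 < m)%N) (alpha_ge0 : 0 <= alpha) (alpha_le1 : alpha <= 1)
  (per : torus_periodic phi) (smooth : C_nu_alpha nu alpha phi)
  (order_ge2 : 2 <= nu%:R + alpha).
Implicit Types (x y v : 'rV[R]_m) (c k : 'rV[int]_m).

Lemma norm1_sqr_le v : norm1 v ^+ 2 <= m%:R * \sum_i v 0 i ^+ 2.
Proof.
rewrite expr2 /norm1 big_distrlr /=.
apply: (@le_trans _ _ (\sum_i \sum_j (2^-1 * v 0 i ^+ 2 + 2^-1 * v 0 j ^+ 2))).
  apply: ler_sum => i _; apply: ler_sum => j _; rewrite -normrM -mulrDr.
  have := sqr_ge0 (`|v 0 i| - `|v 0 j|).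
  rewrite sqrrB !real_normK ?num_real// -normrM; lra.
have E i : \sum_j (2^-1 * v 0 i ^+ 2 + 2^-1 * v 0 j ^+ 2) =
    m%:R * (2^-1 * v 0 i ^+ 2) + 2^-1 * \sum_j v 0 j ^+ 2.
  by rewrite big_split /= big_const_ord iter_addr addr0 mulr_natl -mulr_sumr.
rewrite (eq_bigr _ (fun i _ => E i)) big_split /= -!mulr_sumr big_const_ord iter_addr addr0.
by rewrite -[_ *+ m]mulr_natl le_eqVlt; apply/orP; left; apply/eqP; field.
Qed.

(** The number of cells times the contribution of one cell is 2^(-M) L^M n^(- M p), and n is at most
    2 L^(1/2). *)
Lemma cell_scaling (M p L n : R) : 0 < L -> 0 < n -> n <= 2 * L `^ 2^-1 -> 0 <= M -> 0 <= p ->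
  2 `^ (- (M * (1 + p))) * L `^ (M * (1 - p / 2)) <= (L / (2 * n)) `^ M * n `^ (M * (1 - p)).
Proof.
move=> L0 n0 nL M0 p0.
have powD (z u w : R) : 0 < z -> z `^ (u + w) = z `^ u * z `^ w.
  by move=> z0; rewrite powRD// (gt_eqF z0) implybT.
have two : 0 < 2 :> R by [].
have -> : (L / (2 * n)) `^ M * n `^ (M * (1 - p)) = 2 `^ (- M) * L `^ M * n `^ (- (M * p)).
  rewrite -powR_inv1 ?mulr_ge0 ?(ltW n0)// powRM ?powR_ge0 ?(ltW L0)// -powRrM mulN1r.
  rewrite powRM ?(ltW n0)// (_ : - (M * p) = - M + M * (1 - p)); last by ring.
  by rewrite powD//; ring.
have -> : 2 `^ (- (M * (1 + p))) * L `^ (M * (1 - p / 2)) =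
    2 `^ (- M) * L `^ M * (2 * L `^ 2^-1) `^ (- (M * p)).
  rewrite powRM ?powR_ge0// -powRrM (_ : - (M * (1 + p)) = - M + - (M * p)); last by ring.
  rewrite (_ : M * (1 - p / 2) = M + 2^-1 * - (M * p)); last by field.
  by rewrite !powD//; ring.
rewrite ler_wpM2l ?mulr_ge0 ?powR_ge0// !powRN lef_pV2 ?posrE ?powR_gt0 ?mulr_gt0 ?powR_gt0//.
by apply: ge0_ler_powR; rewrite ?nnegrE ?mulr_ge0 ?powR_ge0 ?(ltW n0).
Qed.

(** Both sides are periodic in [x] since [xi] is integral, so v = x - x0 may be taken in
    [-pi, pi]^m. There 1 - cos theta <= |theta|, which is at most a Taylor error n^2 L |v|_1^2 plus
    a linear error n |v|_1, and squares are compared with 1 - cos by [sqr_le_1Bcos]. *)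
Lemma theta_bound : exists2 C : R, 0 < C & forall (lambda : R) (n : nat) x0 (xi : 'rV[int]_m) x,
  `|lambda| <= n%:R ^+ 2 -> (forall i, `|lambda * partial i phi x0 - (xi 0 i)%:~R| <= n%:R) ->
  1 - cos (lambda * phi x - lambda * phi x0 - kdot xi (x - x0)) <=
  8^-1 + C * n%:R ^+ 2 * \sum_i (1 - cos ((x - x0) 0 i)).
Proof.
have [L L0 HL] := gradient_lipschitz alpha_ge0 alpha_le1 per smooth order_ge2.
have df := phase_differentiable alpha_le1 smooth order_ge2.
have mR : 0 < m%:R :> R by rewrite ltr0n.
exists (8 * (m%:R * (L + 2))); first by rewrite !mulr_gt0// ltr_wpDl.
move=> lambda n x0 xi x ln Hxi.
pose F y := cos (lambda * phi y - lambda * phi x0 - kdot xi (y - x0)).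
have pF : torus_periodic F.
  move=> i y; rewrite /F per !kdotB kdotD kdot_unitv.
  rewrite -[LHS](cosD2pi_int _ (xi 0 i)); congr cos; ring.
have pc i : torus_periodic (fun y : 'rV[R]_m => cos ((y - x0) 0 i)).
  move=> j y; rewrite -[X in cos X = _]kdot_int_unitv -[X in _ =
      cos X]kdot_int_unitv !kdotB kdotD kdot_unitv.
  by rewrite addrAC cosD2pi_int.
have [z Hz] := lattice_reduction (x - x0).
pose v := x + lattice_vector R z - x0.
have vpi i : - pi <= v 0 i <= pi by rewrite /v addrAC; exact: Hz.
rewrite -/(F x) -(periodic_lattice z x pF).
under eq_bigr => i _ do rewrite -(periodic_lattice z x (pc i)).
rewrite /F -/v; have -> : x + lattice_vector R z = x0 + v by rewrite /v addrCA subrr addr0.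
have S0 : 0 <= \sum_i v 0 i ^+ 2 by apply: sumr_ge0 => i _; exact: sqr_ge0.
have cs : \sum_i v 0 i ^+ 2 <= 8 * \sum_i (1 - cos (v 0 i)).
  by rewrite mulr_sumr; apply: ler_sum => i _; apply: sqr_le_1Bcos.
set th := lambda * phi (x0 + v) - _ - _.
have th1 : 1 - cos th <= `|th|.
  by rewrite -[X in X - _]cos0; apply: le_trans (ler_norm _) _; apply:
      le_trans (cos_lipschitz _ _) _; rewrite sub0r normrN.
apply: (le_trans th1).
have thE : th = lambda * (phi (x0 + v) - phi x0 - \sum_i v 0 i * partial i phi x0) +
   \sum_i v 0 i * (lambda * partial i phi x0 - (xi 0 i)%:~R).
  have -> : \sum_i v 0 i * (lambda * partial i phi x0 - (xi 0 i)%:~R) =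
      lambda * (\sum_i v 0 i * partial i phi x0) - kdot xi v.
    by rewrite mulr_sumr /kdot -sumrB; apply: eq_bigr => i _; ring.
  by rewrite /th; ring.
have t1 : `|lambda * (phi (x0 + v) - phi x0 - \sum_i v 0 i * partial i phi x0)| <=
    n%:R ^+ 2 * (L * (m%:R * \sum_i v 0 i ^+ 2)).
  rewrite normrM; apply: ler_pM => //.
  apply: le_trans (lipschitz_gradient_taylor _ _ df L0 HL) _.
  by rewrite ler_wpM2l// norm1_sqr_le.
have t2 : `|\sum_i v 0 i * (lambda * partial i phi x0 - (xi 0 i)%:~R)| <=
    8^-1 + 2 * m%:R * n%:R ^+ 2 * \sum_i v 0 i ^+ 2.
  apply: le_trans (ler_norm_sum _ _ _) _.
  have -> : 8^-1 = \sum_(i < m) (8 * m%:R)^-1 :> R.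
    by rewrite big_const_ord iter_addr addr0 -[_ *+ m]mulr_natl; field; rewrite gt_eqF.
  rewrite mulr_sumr -big_split /=; apply: ler_sum => i _.
  rewrite normrM; apply: (@le_trans _ _ (`|v 0 i| * n%:R)); first by rewrite ler_wpM2l.
  rewrite -[v 0 i ^+ 2]real_normK ?num_real//; move: `|v 0 i| => w.
  (* Divided by 8 m, this square reads n w <= 1 / (8 m) + 2 m n^2 w^2; the constants add up to 1/8
     over the m coordinates. *)
  have := sqr_ge0 (4 * m%:R * n%:R * w - 1) => sq.
  have m8 : 0 < 8 * m%:R :> R by rewrite mulr_gt0.
  rewrite -subr_ge0 -(pmulr_rge0 _ m8).
  rewrite [leRHS](_ : _ = (4 * m%:R * n%:R * w - 1) ^+ 2)//; field; exact: lt0r_neq0.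
rewrite thE; apply: le_trans (ler_normD _ _) _; apply: le_trans (lerD t1 t2) _.
rewrite addrCA lerD2l.
rewrite [leLHS](_ : _ = (n%:R ^+ 2 * (m%:R * (L + 2))) * \sum_i v 0 i ^+ 2); last by ring.
rewrite [leRHS](_ : _ = (n%:R ^+ 2 * (m%:R * (L + 2))) * (8 * \sum_i (1 - cos (v 0 i)))); last
    by ring.
by rewrite ler_wpM2l// !mulr_ge0 ?exprn_ge0// addr_ge0.
Qed.

(** The tent of radius 2 r with r = (B + 1) n has mass at least r^2 (2 r + 1)^m and energy at most m
    3^m (2 r + 1)^m. The factor n^2 of [theta_bound] cancels against r^2, so the inner [B] depends
    neither on [n] nor on [lambda]. *)
Lemma cell_concentration : exists B : nat, forall (lambda : R) (n : nat) x0 c,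
  (0 < n)%N -> `|lambda| <= n%:R ^+ 2 ->
  (forall i, `|lambda * partial i phi x0 - ((c *+ n) 0 i)%:~R| <= n%:R) ->
  2^-1 <= \sum_(d <- frequencies m n B) fourier_abs lambda phi (c *+ n + d).
Proof.
have [C C0 HC] := theta_bound.
have [B HB] : exists B : nat, C * m%:R * (3 ^ m)%N%:R <= 3 / 4 * B.+1%:R ^+ 2.
  exists (Num.truncn (2 * (C * m%:R * (3 ^ m)%N%:R))).
  set w := C * _ * _; pose t : R := (Num.truncn (2 * w)).+1%:R.
  have wt : 2 * w < t by exact: truncnS_gt.
  have t1 : t <= t ^+ 2 by rewrite expr2 ler_peMr// ler1n.
  have t0 : 1 <= t by rewrite ler1n.
  rewrite -/t; lra.
(* Differences of two points of the box of radius 2 r + 1 have size at most 4 r + 2 <= 6 r = 6 (B +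
   1) n. *)
exists (6 * B.+1).+1 => lambda n x0 c n0 ln Hc.
pose r := (B.+1 * n)%N.
have r0 : (0 < r)%N by rewrite muln_gt0.
have phl : exists M, lipschitz1 M phi.
  by have [M _ HM] := phase_lipschitz alpha_ge0 alpha_le1 per smooth order_ge2; exists M.
have mass := @cone_mass R m r.
have pos : 0 < r%:R ^+ 2 * (r.*2.+1 ^ m)%N%:R :> R.
  by rewrite mulr_gt0 ?exprn_gt0 ?ltr0n// expn_gt0.
apply: (concentration (E := C * n%:R ^+ 2) phl (lattice_box_uniq m (r.*2).+1) (@cone_ge0 R m r.*2)
   (@cone_supp R m r.*2) (x0 := x0)).
- apply: (@le_trans _ _ (C * n%:R ^+ 2 * (m%:R * (((r.*2).+1).*2.+1 ^ m)%N%:R))).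
    rewrite ler_wpM2l ?mulr_ge0 ?exprn_ge0 ?(ltW C0)//.
    apply: (@le_trans _ _ (\sum_(i < m) (((r.*2).+1).*2.+1 ^ m)%N%:R)).
      by apply: ler_sum => i _; exact: cone_energy.
    by rewrite big_const_ord iter_addr addr0 mulr_natl.
  apply: le_trans (ler_wpM2l _ mass) => //.
  apply: (@le_trans _ _ (C * n%:R ^+ 2 * (m%:R * ((3 ^ m)%N%:R * (r.*2.+1 ^ m)%N%:R)))).
    rewrite !ler_wpM2l ?mulr_ge0 ?exprn_ge0 ?(ltW C0)// -natrM ler_nat -expnMn.
    by rewrite leq_exp2r//; lia.
  rewrite [leLHS](_ : _ = (C * m%:R * (3 ^ m)%N%:R) * (n%:R ^+ 2 * (r.*2.+1 ^ m)%N%:R)); last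
      by ring.
  rewrite [leRHS](_ : _ = (3 / 4 * B.+1%:R ^+ 2) * (n%:R ^+ 2 * (r.*2.+1 ^ m)%N%:R)); last first.
    by rewrite /r natrM; ring.
  by rewrite ler_wpM2r// mulr_ge0 ?exprn_ge0.
- by move=> x; exact: HC.
- exact: frequencies_uniq.
- move=> l l'; rewrite !mem_lattice_box_maxabs => ls l's.
  apply: mem_frequencies => //; apply: leq_trans (maxabs_add _ _) _; rewrite maxabsN.
  by rewrite -mulnA -/r; lia.
- exact: lt_le_trans pos mass.
Qed.

(** The bound is stated for every upper bound [T] of the finite sums, so that it makes sense before
    the whole sum is known to be finite. *)
Lemma power_sum_lower (p : R) : 1 <= p ->
  positive_measure [set gradient phi x | x in [set: 'rV[R]_m]] ->
  exists2 K : R, 0 < K & forall (lambda T : R), 1 <= `|lambda| ->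
  (forall s, uniq s -> \sum_(k <- s) fourier_abs lambda phi k `^ p <= T) ->
  K * `|lambda| `^ (m%:R * (1 - p / 2)) <= T.
Proof.
move=> p1 pm; have [e e0 He] := positive_measure_cells m_gt0 pm.
have [B HB] := cell_concentration.
pose W : R := (B.*2.+1 ^ m)%N%:R.
have W0 : 0 < W by rewrite ltr0n expn_gt0.
pose K : R := e * 4^-1 * (4 * W) `^ (1 - p) * 2 `^ (- (m%:R * (1 + p))) / W.
exists K.
  by rewrite /K divr_gt0// !mulr_gt0 ?powR_gt0 ?invr_gt0// mulr_gt0.
move=> lambda T l1 HT; pose Lm : R := `|lambda|; rewrite -/Lm.
have L0 : 0 < Lm by exact: lt_le_trans l1.
(* The lower bound sqrt L <= n gives L <= n^2 for the concentration; the upper bound n <= 2 sqrt L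
   is used to count cells. *)
pose n := (Num.truncn (Num.sqrt Lm)).+1.
have sq1 : 1 <= Num.sqrt Lm by rewrite -[leLHS]sqrtr1 ler_sqrt// ltW.
have nl : Num.sqrt Lm <= n%:R by apply/ltW; exact: truncnS_gt.
have nu2 : n%:R <= 2 * Num.sqrt Lm.
  rewrite /n -natr1; have := truncn_le (Num.sqrt Lm); rewrite sqrtr_ge0; lra.
have ln : Lm <= n%:R ^+ 2.
  by rewrite -[leLHS]sqr_sqrtr ?(ltW L0)// lerXn2r ?nnegrE ?sqrtr_ge0.
have nR : 0 < n%:R :> R by rewrite ltr0n.
have lam0 : lambda != 0 by rewrite -normr_gt0.
pose P c := exists x0, forall i, `|lambda * partial i phi x0 - ((c *+ n) 0 i)%:~R| <= n%:R.
(* The grid n Z^m of frequencies, divided by [lambda], becomes a grid for gradient values; its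
   spacing keeps the sign of [lambda], the half-side does not. *)
have [||Cs [uC CP Ce]] := He (n%:R / lambda) (n%:R / Lm) P.
- by rewrite divr_ge0// ltW.
- move=> _ [x0 _ <-]; pose c : 'rV[int]_m := \row_i Num.floor (lambda * partial i phi x0 / n%:R).
  have Hc i : `|lambda * partial i phi x0 - n%:R * (c 0 i)%:~R| <= n%:R.
    rewrite mxE; have /andP[] := Num.Theory.floor_itv (lambda * partial i phi x0 / n%:R).
    rewrite ler_pdivlMr// ltr_pdivrMr// intrD mulrDl; move: (Num.floor _) => z.
    have E (a b d : R) : b <= a -> a < b + d -> `|a - b| <= d.
      by move=> ? ?; rewrite ler_norml; apply/andP; split; lra.
    by move=> a1 a2; rewrite [n%:R * _]mulrC; apply: E a1 _; apply: lt_le_trans a2 _;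
        rewrite [1%:~R * _]mul1r.
  exists c.
    exists x0 => i; rewrite mulmxnE -[_ *+ n]mulr_natr intrM rmorph_nat.
    by rewrite [_%:~R * _]mulrC; exact: Hc.
  move=> i; rewrite mxE.
  rewrite [X in `|X|](_ : _ = (lambda * partial i phi x0 - n%:R * (c 0 i)%:~R) / lambda); last
      by field.
  by rewrite normrM normfV ler_wpM2r ?invr_ge0.
pose Sn : R := (size (frequencies m n B))%:R.
have SE : Sn = W * n%:R ^+ m by rewrite /Sn size_frequencies natrM -/W [(n ^ m)%:R]natrX.
have low : (size Cs)%:R * (4^-1 * (4 * Sn) `^ (1 - p)) <= W * T.
  apply: le_trans (packing_sum n B uC HT).
  rewrite -sum1_size natr_sum mulr_suml big_seq [leRHS]big_seq; apply: ler_sum => c cC.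
  rewrite mul1r -(big_map (fun d => c *+ n + d) xpredT (fun k => fourier_abs lambda phi k `^ p)).
  have -> : Sn = (size [seq c *+ n + d | d <- frequencies m n B])%:R by rewrite size_map.
  apply: power_sum_ge => //; first by move=> k; exact: sqrtr_ge0.
  by rewrite big_map; have [x0 Hx0] := CP c cC; apply: HB Hx0.
have Cs_lower : e * (Lm / (2 * n%:R)) ^+ m <= (size Cs)%:R.
  rewrite -ler_pdivlMr ?exprn_gt0 ?divr_gt0 ?mulr_gt0// -exprVn invf_div.
  by rewrite -mulrA; exact: ltW.
have step : e * (Lm / (2 * n%:R)) ^+ m * (4^-1 * (4 * Sn) `^ (1 - p)) <= W * T.
  by apply: le_trans low; rewrite ler_wpM2r// mulr_ge0 ?powR_ge0.
have m0 : 0 <= m%:R :> R by exact: ler0n.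
have nL : n%:R <= 2 * Lm `^ 2^-1 by rewrite powR12_sqrt// ltW.
have := @cell_scaling m%:R p Lm n%:R L0 nR nL m0 (le_trans ler01 p1).
have -> : (Lm / (2 * n%:R)) `^ m%:R = (Lm / (2 * n%:R)) ^+ m.
  by rewrite powR_mulrn// divr_ge0 ?mulr_ge0// ltW.
have e1 : (4 * Sn) `^ (1 - p) = (4 * W) `^ (1 - p) * n%:R `^ (m%:R * (1 - p)).
  by rewrite SE mulrA powRM ?exprn_ge0 ?mulr_ge0 ?(ltW W0)// -powR_mulrn// -powRrM.
rewrite e1 in step => sc; rewrite -(ler_pM2l W0); apply: le_trans step.
rewrite [leLHS](_ : _ = e * 4^-1 * (4 * W) `^ (1 - p) *
  (2 `^ (- (m%:R * (1 + p))) * Lm `^ (m%:R * (1 - p / 2)))); last first.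
  by rewrite /K; field; rewrite gt_eqF.
rewrite [leRHS](_ : _ = e * 4^-1 * (4 * W) `^ (1 - p) *
  ((Lm / (2 * n%:R)) ^+ m * n%:R `^ (m%:R * (1 - p)))); last by ring.
by apply: ler_wpM2l sc; rewrite !mulr_ge0 ?powR_ge0 ?invr_ge0// ltW.
Qed.

End LowerBound.

(** * The norm *)

Section Norm.
Variables (R : realType) (m : nat) (p lambda : R) (phi : 'rV[R]_m -> R).
Hypothesis p_gt0 : 0 < p.

Let b k := fourier_abs lambda phi k `^ p.
Let E := esum [set: 'rV[int]_m] (fun k => (b k)%:E).

Let sum_le_esum s : uniq s -> ((\sum_(k <- s) b k)%:E <= E)%E.
Proof.
move=> us; apply: ereal_sup_ubound; exists [set` s]; first by split=> //; exact: finite_seq.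
by rewrite -fsbig_seq// sumEFin.
Qed.

Let esum_le (C : R) : (forall s, uniq s -> \sum_(k <- s) b k <= C) -> (E <= C%:E)%E.
Proof.
move=> H; apply: ge_ereal_sup => _ [A [fA _] <-].
by rewrite fsbig_finite// sumEFin lee_fin; apply: H; exact: finmap.fset_uniq.
Qed.

Lemma Ap_norm_exp_le (C : R) : (forall s, uniq s -> \sum_(k <- s) b k <= C) ->
  (Ap_norm_exp p lambda phi <= (C `^ p^-1)%:E)%E.
Proof.
move=> H; have := esum_le H; have := sum_le_esum (isT : uniq [::]); rewrite big_nil.
rewrite /Ap_norm_exp -/E; case: E => // r; rewrite !lee_fin => r0 rC.
by apply: ge0_ler_powR; rewrite ?nnegrE ?invr_ge0 ?(ltW p_gt0)//; exact: le_trans rC.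
Qed.

Lemma Ap_norm_exp_ge (c : R) : 0 <= c ->
  (forall C, (forall s, uniq s -> \sum_(k <- s) b k <= C) -> c <= C) ->
  ((c `^ p^-1)%:E <= Ap_norm_exp p lambda phi)%E.
Proof.
move=> c0 H; have S := sum_le_esum; rewrite /Ap_norm_exp -/E.
case: E S => [r| |] S; rewrite ?leey//.
have cr : c <= r by apply: H => s us; have := S s us; rewrite lee_fin.
rewrite lee_fin; apply: ge0_ler_powR; rewrite ?nnegrE ?invr_ge0 ?(ltW p_gt0)//.
exact: le_trans cr.
Qed.

End Norm.

Theorem theorem4 (R : realType) (m : nat) (p alpha : R) (nu : nat)
  (phi : 'rV[R]_m -> R) :
  (0 < m)%N -> 1 <= p -> p < 2 -> 0 <= alpha -> alpha <= 1 ->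
  torus_periodic phi -> C_nu_alpha nu alpha phi ->
  positive_measure [set gradient phi x | x in [set: 'rV[R]_m]] ->
  2 <= nu%:R + alpha ->
  m%:R * (p^-1 - 2^-1) < nu%:R + alpha ->
  asymp_equiv (fun lambda => Ap_norm_exp p lambda phi)
              (fun lambda => `|lambda| `^ (m%:R * (p^-1 - 2^-1))).
Proof.
move=> m0 p1 p2 a0 a1 per smooth pm o2 mp.
have p0 : 0 < p by exact: lt_le_trans p1.
have [K K0 HK] := dyadic_l2_bound a0 a1 per smooth o2.
have b0 : 0 <= nu%:R + alpha by rewrite addr_ge0.
have [C C0 HC] := dyadic_power_sum p0 p2 K0 b0 mp m0.
have [c c0 Hc] := power_sum_lower m0 a0 a1 per smooth o2 p1 pm.
(* Both estimates concern p-th power sums; the root turns m (1 - p / 2) into m (1/p - 1/2). *)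
have expE (d L : R) : 0 < d -> (d * L `^ (m%:R * (1 - p / 2))) `^ p^-1 =
    d `^ p^-1 * L `^ (m%:R * (p^-1 - 2^-1)).
  move=> d0; rewrite powRM ?powR_ge0 ?(ltW d0)// -powRrM.
  by congr (_ * _ `^ _); field; rewrite gt_eqF.
exists (c `^ p^-1), (C `^ p^-1), 1; rewrite !powR_gt0//; do 2!split=> //.
move=> lambda l1; split.
- rewrite -expE//; apply: Ap_norm_exp_ge => //; first by rewrite mulr_ge0 ?powR_ge0// ltW.
  by move=> T HT; exact: Hc.
- rewrite -expE//; apply: Ap_norm_exp_le => // s us.
  apply: HC => //.
  + by move=> k; exact: fourier_abs_ge0.
  + by move=> t ut; exact: (l2_bound a0 a1 per smooth o2).
  + by move=> j i t ut Ht; exact: HK Ht.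
Qed.
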